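(* Let $\mathcal K$ be a real Hilbert space with scalar product $\langle\cdot,\cdot\rangle$ and norm $\|\cdot\|$. Let $\alpha,\beta\in\,]0,+\infty[$, let $(\eta_n)_{n\in\mathbb N}$ be a summable sequence in $[0,+\infty[$, and let $(U_n)_{n\in\mathbb N}$ be a sequence in $\mathcal B(\mathcal K)$ such that $$\mu=\sup_{n\in\mathbb N}\|U_n\|<+\infty\quad\text{and}\quad (\forall n\in\mathbb N)\ \ (1+\eta_n)U_{n+1}\succcurlyeq U_n\in\mathcal P_\alpha(\mathcal K).$$ Let $A\colon\mathcal K\to2^{\mathcal K}$ be maximally monotone, and let $B\colon\mathcal K\to\mathcal K$ be monotone and $\beta$-Lipschitzian, with $\operatorname{zer}(A+B)\neq\varnothing$. Let $(a_n)_{n\in\mathbb N}$, $(b_n)_{n\in\mathbb N}$, $(c_n)_{n\in\mathbb N}$ be sequences in $\mathcal K$ with $\sum_n\|a_n\|<\infty$, $\sum_n\|b_n\|<\infty$, $\sum_n\|c_n\|<\infty$. Let $x_0\in\mathcal K$, let $\varepsilon\in\,]0,1/(\beta\mu+1)[$, let $(\gamma_n)_{n\in\mathbb N}$ be a sequence in $[\varepsilon,(1-\varepsilon)/(\beta\mu)]$, and for every $n\in\mathbb N$ set $$y_n=x_n-\gamma_nU_n(Bx_n+a_n),\quad p_n=J_{\gamma_nU_nA}y_n+b_n,\quad q_n=p_n-\gamma_nU_n(Bp_n+c_n),\quad x_{n+1}=x_n-y_n+q_n.$$ Then there exists $\overline x\in\operatorname{zer}(A+B)$ such that: (i) $\sum_{n}\|x_n-p_n\|^2<+\infty$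 and $\sum_n\|y_n-q_n\|^2<+\infty$; (ii) $x_n\rightharpoonup\overline x$ and $p_n\rightharpoonup\overline x$; (iii) if one of the following holds: (a) $\liminf_{n} d_{\operatorname{zer}(A+B)}(x_n)=0$; (b) $A+B$ is demiregular at $\overline x$; (c) $A$ or $B$ is uniformly monotone at $\overline x$; (d) $\operatorname{int}\operatorname{zer}(A+B)\neq\varnothing$ and there exists a summable sequence $(\nu_n)_{n\in\mathbb N}$ in $[0,+\infty[$ such that $(\forall n\in\mathbb N)$ $(1+\nu_n)U_n\succcurlyeq U_{n+1}$; then $x_n\to\overline x$ and $p_n\to\overline x$.
   Context: $\mathcal B(\mathcal K)$ is the space of bounded linear operators on $\mathcal K$. For self-adjoint $M_1,M_2\in\mathcal B(\mathcal K)$, $M_1\succcurlyeq M_2$ means $\langle M_1x,x\rangle\ge\langle M_2x,x\rangle$ for all $x$. $\mathcal P_\alpha(\mathcal K)=\{M\in\mathcal B(\mathcal K): M^*=M,\ M\succcurlyeq\alpha\operatorname{Id}\}$. For an operator $T\colon\mathcal K\to2^{\mathcal K}$, $J_T=(\operatorname{Id}+T)^{-1}$ is its resolvent; $\gamma U A$ denotes the operator $x\mapsto \gamma U(Ax)$ (its resolvent is single-valued and everywhere defined when $U\in\mathcal P_\alpha(\mathcal K)$, $\gamma>0$ and $A$ is maximally monotone). $\operatorname{zer}T=\{x:0\in Tx\}$, $d_C$ is the distance to a set $C$, $\rightharpoonup$ denotes weak and $\to$ strong convergence. $T$ is uniformly monotone at $x\in\operatorname{dom}T$ if there is an increasing function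 $\phi\colon[0,+\infty[\to[0,+\infty]$ vanishing only at $0$ with $\langle x-y,u-v\rangle\ge\phi(\|x-y\|)$ for all $u\in Tx$ and $(y,v)\in\operatorname{gra}T$. $T$ is demiregular at $x\in\operatorname{dom}T$ if for every sequence $(x_n,u_n)$ in $\operatorname{gra}T$ and every $u\in Tx$ with $x_n\rightharpoonup x$ and $u_n\to u$, one has $x_n\to x$. *)

(* Defs.v *)
From Stdlib Require Import Reals Lra.
Open Scope R_scope.
Set Implicit Arguments.

Record Hilbert := {
  hcar :> Type;
  hzero : hcar;
  hadd : hcar -> hcar -> hcar;
  hopp : hcar -> hcar;
  hscal : R -> hcar -> hcar;
  hinner : hcar -> hcar -> R;
  hadd_assoc : forall x y z, hadd x (hadd y z) = hadd (hadd x y) z;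
  hadd_comm : forall x y, hadd x y = hadd y x;
  hadd_zero : forall x, hadd hzero x = x;
  hadd_opp : forall x, hadd x (hopp x) = hzero;
  hscal_one : forall x, hscal 1 x = x;
  hscal_assoc : forall a b x, hscal a (hscal b x) = hscal (a * b) x;
  hscal_distr_l : forall a x y, hscal a (hadd x y) = hadd (hscal a x) (hscal a y);
  hscal_distr_r : forall a b x, hscal (a + b) x = hadd (hscal a x) (hscal b x);
  hinner_sym : forall x y, hinner x y = hinner y x;
  hinner_add_l : forall x y z, hinner (hadd x y) z = hinner x z + hinner y z;
  hinner_scal_l : forall a x y, hinner (hscal a x) y = a * hinner x y;
  hinner_pos : forall x, 0 <= hinner x x;
  hinner_def : forall x, hinner x x = 0 -> x = hzero;
  hcomplete : forall u : nat -> hcar,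
    (forall eps, eps > 0 -> exists N, forall m n, (m >= N)%nat -> (n >= N)%nat ->
        sqrt (hinner (hadd (u m) (hopp (u n))) (hadd (u m) (hopp (u n)))) < eps) ->
    exists l, Un_cv (fun n => sqrt (hinner (hadd (u n) (hopp l)) (hadd (u n) (hopp l)))) 0
}.

Arguments hzero {h}.
Arguments hadd {h}.
Arguments hopp {h}.
Arguments hscal {h}.
Arguments hinner {h}.

(** Set-valued operators K -> 2^K are relations: [T x u] means u ∈ T x. *)
Definition setop (K : Hilbert) := K -> K -> Prop.

Section Ops.
Context {K : Hilbert}.
Local Notation setop := (setop K).

Definition hsub (x y : K) : K := hadd x (hopp y).
Definition norm (x : K) : R := sqrt (hinner x x).

Definition is_bounded_linear (U : K -> K) : Prop :=
  (forall x y, U (hadd x y) = hadd (U x) (U y)) /\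
  (forall a x, U (hscal a x) = hscal a (U x)) /\
  (exists c, forall x, norm (U x) <= c * norm x).

Definition opnorm_is (U : K -> K) (r : R) : Prop :=
  is_lub (fun s => exists x, norm x <= 1 /\ s = norm (U x)) r.

Definition self_adjoint (M : K -> K) : Prop :=
  forall x y, hinner (M x) y = hinner x (M y).

Definition loewner_ge (M1 M2 : K -> K) : Prop :=
  forall x, hinner (M2 x) x <= hinner (M1 x) x.

Definition in_P (alpha : R) (M : K -> K) : Prop :=
  is_bounded_linear M /\ self_adjoint M /\ loewner_ge M (fun x => hscal alpha x).

Definition op_scal (c : R) (M : K -> K) : K -> K := fun x => hscal c (M x).

Definition monotone (T : setop) : Prop :=
  forall x y u v, T x u -> T y v -> 0 <= hinner (hsub x y) (hsub u v).

Definition maximally_monotone (T : setop) : Prop :=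
  monotone T /\
  (forall x u, (forall y v, T y v -> 0 <= hinner (hsub x y) (hsub u v)) -> T x u).

Definition graph (B : K -> K) : setop := fun x u => u = B x.

Definition single_monotone (B : K -> K) : Prop := monotone (graph B).

Definition lipschitz (beta : R) (B : K -> K) : Prop :=
  forall x y, norm (hsub (B x) (B y)) <= beta * norm (hsub x y).

Definition op_sum (A : setop) (B : K -> K) : setop :=
  fun x w => exists u, A x u /\ w = hadd u (B x).

Definition zer (T : setop) : K -> Prop := fun x => T x hzero.

Definition op_scaled (gamma : R) (U : K -> K) (A : setop) : setop :=
  fun x w => exists u, A x u /\ w = hscal gamma (U u).

(** Resolvent J_T = (Id + T)^{-1}, as a relation: [resolvent T y p] means p ∈ J_T y. *)
Definition resolvent (T : setop) (y p : K) : Prop :=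
  exists w, T p w /\ y = hadd p w.

Definition summable (u : nat -> R) : Prop := exists l, infinite_sum u l.

Definition weak_cv (u : nat -> K) (l : K) : Prop :=
  forall z, Un_cv (fun n => hinner (u n) z) (hinner l z).

Definition strong_cv (u : nat -> K) (l : K) : Prop :=
  Un_cv (fun n => norm (hsub (u n) l)) 0.

Definition is_glb (E : R -> Prop) (m : R) : Prop :=
  (forall r, E r -> m <= r) /\ (forall b, (forall r, E r -> b <= r) -> b <= m).

Definition dist_is (C : K -> Prop) (x : K) (d : R) : Prop :=
  is_glb (fun r => exists z, C z /\ r = norm (hsub x z)) d.

Definition liminf_is (u : nat -> R) (l : R) : Prop :=
  is_lub (fun s => exists N, is_glb (fun r => exists n, (n >= N)%nat /\ r = u n) s) l.

Definition demiregular_at (T : setop) (x : K) : Prop :=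
  forall (xs us : nat -> K) (u : K),
    (forall n, T (xs n) (us n)) -> T x u ->
    weak_cv xs x -> strong_cv us u -> strong_cv xs x.

Definition interior_nonempty (C : K -> Prop) : Prop :=
  exists z r, r > 0 /\ forall w, norm (hsub w z) < r -> C w.

End Ops.

Inductive Rbar := Fin (r : R) | Pinf.

Definition Rbar_le (a b : Rbar) : Prop :=
  match a, b with
  | Fin x, Fin y => x <= y
  | _, Pinf => True
  | Pinf, Fin _ => False
  end.

Definition uniformly_monotone_at (K : Hilbert) (T : setop K) (x : K) : Prop :=
  (exists u, T x u) /\
  exists phi : R -> Rbar,
    (forall t, 0 <= t -> Rbar_le (Fin 0) (phi t)) /\
    (forall s t, 0 <= s -> s <= t -> Rbar_le (phi s) (phi t)) /\
    phi 0 = Fin 0 /\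
    (forall t, 0 < t -> phi t <> Fin 0) /\
    (forall u y v, T x u -> T y v ->
       Rbar_le (phi (norm (hsub x y))) (Fin (hinner (hsub x y) (hsub u v)))).

(* Main.v *)
(** Put [P n = prod_{k<n} (1 + eta k)]: the operators [T n = P n U n] increase with [n], so the
    metrics [M n = (T n)^-1] decrease.  With [r n = p n - b n], an exact resolvent value, the
    Lipschitz bound on [B] and the step bound [gamma n <= (1 - eps) / (beta mu)] give a descent
    inequality for [<M n (x n - z), x n - z>], z a zero of [A + B], up to summable perturbations;
    the Robbins-Siegmund lemma then yields (i) and the convergence of these quantities.  Weak
    convergence follows from Opial's argument, the [M n] converging strongly.  Weak cluster points
    are taken to be points of the intersection of the closed convex hulls of the tails of a
    sequence, which exist by a minimal-norm argument and suffice since all the conditions to be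
    passed to the limit are affine. *)
Require Import Defs.
From Stdlib Require Import Reals Lra Lia Psatz Classical ClassicalEpsilon.
Open Scope R_scope.

(** The hypothesis on [U] is only approximate monotonicity; the products [P n] make it exact, and
    [d n = gamma n / P n] leaves the algorithm unchanged because [d n T n = gamma n U n]. The metric
    has to be the inverse of [T n]: the displacement of a step is, up to errors, [d n T n] applied
    to an element of [(A + B) (r n)], and [M n] cancels [T n], so that plain monotonicity of [A] and
    [B] gives a sign. The obstacle in the weak limit is that [B] is only weakly controlled:
    [<r n, B (r n)>] has no evident limit, and closedness of the graph of [A + B] is not at hand.
    The pair [(x n, B (r n))] is therefore followed in [K * K]: once [u n + B (r n)] tends to 0
    strongly, the two monotonicity inequalities add up to a condition that is affine in this pair. A
    cluster point in the sense of hulls comes without a subsequence. Index sets are selected by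
    predicates instead, and two cluster points are compared through scalar sequences that converge
    along all indices. In case (d) the images [M n (x n - z0)] are easier to control than the
    iterates, since moving the zero [z] changes [V z n] by a term linear in them. *)

Arguments hinner_sym {h}.
Arguments hinner_pos {h}.
Arguments hinner_def {h}.
Arguments hadd_assoc {h}.
Arguments hadd_comm {h}.
Arguments hadd_zero {h}.
Arguments hadd_opp {h}.

(** * Inner product spaces *)

Section InnerProduct.
Context {K : Hilbert}.
Implicit Types x y z : K.

Lemma inner_add_r x y z : hinner x (hadd y z) = hinner x y + hinner x z.
Proof. rewrite hinner_sym, hinner_add_l, (hinner_sym y), (hinner_sym z); reflexivity. Qed.

Lemma inner_scal_r a x y : hinner x (hscal a y) = a * hinner x y.
Proof. rewrite hinner_sym, hinner_scal_l, (hinner_sym y); reflexivity. Qed.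

Lemma inner_zero_l x : hinner hzero x = 0.
Proof.
  assert (H : hinner (hadd hzero hzero) x = hinner hzero x) by (rewrite hadd_zero; reflexivity).
  rewrite hinner_add_l in H; lra.
Qed.

Lemma inner_opp_l x y : hinner (hopp x) y = - hinner x y.
Proof.
  assert (H : hinner (hadd x (hopp x)) y = 0) by (rewrite hadd_opp; apply inner_zero_l).
  rewrite hinner_add_l in H; lra.
Qed.

Lemma inner_opp_r x y : hinner x (hopp y) = - hinner x y.
Proof. rewrite hinner_sym, inner_opp_l, hinner_sym; reflexivity. Qed.

Lemma inner_zero_r x : hinner x hzero = 0.
Proof. rewrite hinner_sym; apply inner_zero_l. Qed.

Lemma inner_sub_l x y z : hinner (hsub x y) z = hinner x z - hinner y z.
Proof. unfold hsub; rewrite hinner_add_l, inner_opp_l; ring. Qed.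

Lemma inner_sub_r x y z : hinner z (hsub x y) = hinner z x - hinner z y.
Proof. unfold hsub; rewrite inner_add_r, inner_opp_r; ring. Qed.

Lemma inner_ext x y : (forall z, hinner x z = hinner y z) -> x = y.
Proof.
  intros H.
  assert (E : hsub x y = hzero).
  { apply hinner_def; rewrite inner_sub_l, H; ring. }
  rewrite <- (hadd_zero y), <- E; unfold hsub.
  rewrite <- hadd_assoc, (hadd_comm _ y), hadd_opp, hadd_comm, hadd_zero; reflexivity.
Qed.

End InnerProduct.

Ltac inner_expand :=
  rewrite ?hinner_add_l, ?hinner_scal_l, ?inner_add_r, ?inner_scal_r, ?inner_sub_l, ?inner_sub_r,
    ?inner_opp_l, ?inner_opp_r, ?inner_zero_l, ?inner_zero_r.

Ltac inner_expand_all := repeat progress inner_expand.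

(** Vectors are compared through their inner products with an arbitrary vector, which turns linear
    vector identities into ring identities over the reals. *)
Ltac vec := apply inner_ext; let z := fresh in intros z; inner_expand_all; try ring.

Section Norm.
Context {K : Hilbert}.
Implicit Types x y z : K.

Lemma norm_ge0 x : 0 <= norm x.
Proof. apply sqrt_pos. Qed.

Lemma norm_sq x : norm x ^ 2 = hinner x x.
Proof. unfold norm; apply pow2_sqrt, hinner_pos. Qed.

Lemma norm_le_sq x k : 0 <= k -> hinner x x <= k ^ 2 -> norm x <= k.
Proof. intros Hk H; rewrite <- norm_sq in H; pose proof (norm_ge0 x); apply Rnot_lt_le; intro; nra. Qed.

Lemma sq_le_norm x k : norm x <= k -> hinner x x <= k ^ 2.
Proof. intros H; rewrite <- norm_sq; apply pow_incr; split; auto; apply norm_ge0. Qed.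

(* Expand [|norm y x - norm x y|^2 >= 0]. *)
Lemma inner_le_norm x y : hinner x y <= norm x * norm y.
Proof.
  pose proof (norm_ge0 x) as Hx; pose proof (norm_ge0 y) as Hy.
  pose proof (norm_sq x) as Sx; pose proof (norm_sq y) as Sy.
  destruct (Req_dec (norm x) 0) as [Z|Z].
  { rewrite Z in Sx; rewrite (hinner_def x) by (rewrite <- Sx; ring).
    rewrite inner_zero_l, Rmult_comm; apply Rmult_le_pos; auto; apply norm_ge0. }
  destruct (Req_dec (norm y) 0) as [Z'|Z'].
  { rewrite Z' in Sy; rewrite (hinner_def y) by (rewrite <- Sy; ring).
    rewrite inner_zero_r; apply Rmult_le_pos; auto; apply norm_ge0. }
  pose proof (hinner_pos (hsub (hscal (norm y) x) (hscal (norm x) y))) as P.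
  revert P; inner_expand_all; rewrite (hinner_sym y x), <- Sx, <- Sy; intros P.
  apply Rmult_le_reg_l with (norm x * norm y); [ | nra].
  apply Rmult_lt_0_compat; lra.
Qed.

Lemma norm_scal a x : norm (hscal a x) = Rabs a * norm x.
Proof.
  unfold norm; rewrite hinner_scal_l, inner_scal_r, <- Rmult_assoc, sqrt_mult_alt by apply Rle_0_sqr.
  change (a * a) with (Rsqr a); rewrite sqrt_Rsqr_abs; reflexivity.
Qed.

Lemma norm_add x y : norm (hadd x y) <= norm x + norm y.
Proof.
  pose proof (norm_ge0 x); pose proof (norm_ge0 y).
  apply norm_le_sq; [lra|]; inner_expand_all; rewrite (hinner_sym y x), <- !norm_sq.
  pose proof (inner_le_norm x y); nra.
Qed.

Lemma norm_opp x : norm (hopp x) = norm x.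
Proof. unfold norm; rewrite inner_opp_l, inner_opp_r; f_equal; ring. Qed.

Lemma norm_sub x y : norm (hsub x y) <= norm x + norm y.
Proof. rewrite <- (norm_opp y); apply norm_add. Qed.

Lemma norm_sub_sym x y : norm (hsub x y) = norm (hsub y x).
Proof. rewrite <- norm_opp; f_equal; vec. Qed.

Lemma norm_sub_triangle z x y : norm (hsub x y) <= norm (hsub x z) + norm (hsub z y).
Proof. replace (hsub x y) with (hadd (hsub x z) (hsub z y)) by vec; apply norm_add. Qed.

Lemma norm_le_add_sub x y : norm x <= norm y + norm (hsub x y).
Proof. replace x with (hadd y (hsub x y)) at 1 by vec; apply norm_add. Qed.

Lemma inner_abs_le x y : Rabs (hinner x y) <= norm x * norm y.
Proof.
  apply Rabs_le; split; [ | apply inner_le_norm].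
  pose proof (inner_le_norm (hopp x) y) as H; rewrite inner_opp_l, norm_opp in H; lra.
Qed.

Lemma norm_zero : norm (@hzero K) = 0.
Proof. unfold norm; rewrite inner_zero_l; apply sqrt_0. Qed.

Lemma inner_self_le0 x : hinner x x <= 0 -> x = hzero.
Proof. intros H; apply hinner_def; pose proof (hinner_pos x); lra. Qed.

End Norm.

(** * Real sequences *)

Lemma Rabs_le_inv a b : Rabs a <= b -> - b <= a <= b.
Proof. unfold Rabs; destruct Rcase_abs; lra. Qed.

(** The sum has [n] terms, the empty sum included, so that [psum f m - psum f n] is the block from
    [n] to [m - 1]. *)
Fixpoint psum (f : nat -> R) n := match n with O => 0 | S n => psum f n + f n end.

(** Summability of a nonnegative sequence, encoded by bounded partial sums: comparison and linear
    combinations then involve no limits. *)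
Definition nnsum (f : nat -> R) := (forall n, 0 <= f n) /\ exists C, forall n, psum f n <= C.

Lemma psum_sum_f_R0 f n : sum_f_R0 f n = psum f (S n).
Proof. induction n as [|n IH]; simpl in *; [ring | rewrite IH; ring]. Qed.

Lemma psum_mono f n m : (forall n, 0 <= f n) -> (n <= m)%nat -> psum f n <= psum f m.
Proof. intros H L; induction L as [|m L IH]; simpl; [lra | specialize (H m); lra]. Qed.

Lemma psum_le f g n : (forall n, f n <= g n) -> psum f n <= psum g n.
Proof. intros H; induction n as [|n IH]; simpl; [lra | specialize (H n); lra]. Qed.

Lemma psum_add f g n : psum (fun n => f n + g n) n = psum f n + psum g n.
Proof. induction n as [|n IH]; simpl; [ring | rewrite IH; ring]. Qed.

Lemma psum_scal k f n : psum (fun n => k * f n) n = k * psum f n.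
Proof. induction n as [|n IH]; simpl; [ring | rewrite IH; ring]. Qed.

Lemma nnsum_cv f : nnsum f -> exists l, Un_cv (psum f) l.
Proof.
  intros [H [C HC]].
  destruct (growing_cv (psum f)) as [l Hl]; [ | | exists l; exact Hl].
  - intros n; simpl; specialize (H n); lra.
  - exists C; intros y [n ->]; apply HC.
Qed.

Lemma nnsum_summable f : nnsum f -> summable f.
Proof.
  intros H; destruct (nnsum_cv f H) as [l Hl]; exists l.
  intros e He; destruct (Hl e He) as [N HN]; exists N; intros n Hn.
  rewrite psum_sum_f_R0; apply HN; lia.
Qed.

Lemma summable_nnsum f : (forall n, 0 <= f n) -> summable f -> nnsum f.
Proof.
  intros H [l Hl]; split; auto; exists l; intros n.
  apply Rle_trans with (psum f (S n)); [apply psum_mono; auto; lia|].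
  rewrite <- psum_sum_f_R0; apply growing_ineq with (Un := sum_f_R0 f); auto.
  intros k; simpl; specialize (H (S k)); lra.
Qed.

Lemma nnsum_le f g : nnsum g -> (forall n, 0 <= f n <= g n) -> nnsum f.
Proof.
  intros [Hg [C HC]] H; split; [intros n; apply H|].
  exists C; intros n; apply Rle_trans with (2 := HC n), psum_le; intros k; apply H.
Qed.

Lemma nnsum_add f g : nnsum f -> nnsum g -> nnsum (fun n => f n + g n).
Proof.
  intros [Hf [C HC]] [Hg [D HD]]; split.
  - intros n; specialize (Hf n); specialize (Hg n); lra.
  - exists (C + D); intros n; rewrite psum_add; specialize (HC n); specialize (HD n); lra.
Qed.

Lemma nnsum_scal k f : 0 <= k -> nnsum f -> nnsum (fun n => k * f n).
Proof.
  intros Hk [Hf [C HC]]; split.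
  - intros n; apply Rmult_le_pos; auto.
  - exists (k * C); intros n; rewrite psum_scal; apply Rmult_le_compat_l; auto.
Qed.

Lemma nnsum_cv0 f : nnsum f -> Un_cv f 0.
Proof.
  intros H; destruct (nnsum_cv f H) as [l Hl]; intros e He.
  destruct (Hl (e / 2)) as [N HN]; [lra|]; exists N; intros n Hn.
  pose proof (HN n Hn) as H1; pose proof (HN (S n) ltac:(lia)) as H2; simpl in H2.
  unfold Rdist in *; replace (f n - 0) with ((psum f n + f n - l) - (psum f n - l)) by ring.
  revert H1 H2; unfold Rabs; repeat destruct Rcase_abs; lra.
Qed.

Lemma nnsum_bounded f : nnsum f -> exists C, 0 <= C /\ forall n, f n <= C.
Proof.
  intros [H [C HC]]; exists C; split; [apply (HC O)|]; intros n.
  pose proof (HC (S n)) as HS; simpl in HS.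
  pose proof (psum_mono f 0 n H ltac:(lia)) as H0; simpl in H0; lra.
Qed.

Lemma nnsum_tail f e : nnsum f -> 0 < e ->
  exists N, forall n m, (N <= n)%nat -> (n <= m)%nat -> psum f m - psum f n < e.
Proof.
  intros H He; destruct (nnsum_cv f H) as [l Hl].
  destruct (Hl (e / 2)) as [N HN]; [lra|]; exists N; intros n m Hn Hm.
  pose proof (HN n Hn) as H1; pose proof (HN m ltac:(lia)) as H2.
  revert H1 H2; unfold Rdist, Rabs; repeat destruct Rcase_abs; lra.
Qed.

Lemma nnsum_sq f : nnsum f -> nnsum (fun n => f n ^ 2).
Proof.
  intros H; destruct (nnsum_bounded f H) as [C [HC Hf]]; pose proof (proj1 H) as P.
  apply nnsum_le with (fun n => C * f n); [apply nnsum_scal; auto|].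
  intros n; specialize (P n); specialize (Hf n); nra.
Qed.

Lemma cv_le f g : Un_cv g 0 -> (forall n, 0 <= f n <= g n) -> Un_cv f 0.
Proof.
  intros H L e He; destruct (H e He) as [N HN]; exists N; intros n Hn; specialize (HN n Hn).
  specialize (L n); revert HN; unfold Rdist, Rabs; repeat destruct Rcase_abs; lra.
Qed.

Lemma cv_scal0 k f : Un_cv f 0 -> Un_cv (fun n => k * f n) 0.
Proof.
  intros H; replace 0 with (k * 0) by ring; apply CV_mult; auto.
  intros e He; exists O; intros; unfold Rdist; rewrite Rminus_diag, Rabs_R0; auto.
Qed.

Lemma cv_add0 f g : Un_cv f 0 -> Un_cv g 0 -> Un_cv (fun n => f n + g n) 0.
Proof. intros H H'; replace 0 with (0 + 0) by ring; apply CV_plus; auto. Qed.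

Lemma cv_sq0 f : (forall n, 0 <= f n) -> Un_cv (fun n => f n ^ 2) 0 -> Un_cv f 0.
Proof.
  intros P H e He; destruct (H (e ^ 2)) as [N HN]; [nra|]; exists N; intros n Hn.
  specialize (HN n Hn); specialize (P n); revert HN; unfold Rdist.
  rewrite !Rminus_0_r, !Rabs_pos_eq by nra; intros; nra.
Qed.

Lemma cv_ext f g l : (forall n, f n = g n) -> Un_cv f l -> Un_cv g l.
Proof. intros E H e He; destruct (H e He) as [N HN]; exists N; intros n Hn; rewrite <- E; auto. Qed.

Lemma cv_shift0 f g l : Un_cv g l -> Un_cv (fun n => f n - g n) 0 -> Un_cv f l.
Proof.
  intros H H'; apply cv_ext with (fun n => (f n - g n) + g n); [intros; ring|].
  replace l with (0 + l) by ring; apply CV_plus; auto.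
Qed.

Lemma cv_abs_le f g l : Un_cv g 0 -> (forall n, Rabs (f n - l) <= g n) -> Un_cv f l.
Proof.
  intros H L e He; destruct (H e He) as [N HN]; exists N; intros n Hn; specialize (HN n Hn).
  specialize (L n); unfold Rdist in *; rewrite Rminus_0_r in HN; pose proof (Rle_abs (g n)); lra.
Qed.

Lemma decreasing_bounded_cv f c : (forall n, f (S n) <= f n) -> (forall n, c <= f n) ->
  exists l, Un_cv f l.
Proof.
  intros H L; destruct (decreasing_cv f) as [l Hl]; [exact H | | exists l; exact Hl].
  exists (- c); intros y [n ->]; unfold opp_seq; specialize (L n); lra.
Qed.

(** * Infinite products and the Robbins-Siegmund lemma *)

Fixpoint pprod (f : nat -> R) n := match n with O => 1 | S n => pprod f n * (1 + f n) end.

Lemma pprod_ge1 f n : (forall n, 0 <= f n) -> 1 <= pprod f n.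
Proof. intros H; induction n as [|n IH]; simpl; [lra | specialize (H n); nra]. Qed.

(** Since [1 + t <= exp t], the product is at most the exponential of the sum. *)
Lemma pprod_bounded f : nnsum f -> exists E, 1 <= E /\ forall n, pprod f n <= E.
Proof.
  intros [H [C HC]]; exists (exp C).
  assert (L : forall n, pprod f n <= exp (psum f n)).
  { induction n as [|n IH]; simpl; [rewrite exp_0; lra|].
    rewrite exp_plus; pose proof (exp_ineq1_le (f n)); pose proof (pprod_ge1 f n H).
    specialize (H n); apply Rmult_le_compat; lra. }
  assert (I : forall n, exp (psum f n) <= exp C).
  { intros n; destruct (HC n) as [h|h]; [apply Rlt_le, exp_increasing, h | rewrite h; lra]. }
  split; [ | intros n; eapply Rle_trans; [apply L | apply I]].
  specialize (I O); simpl in I; rewrite exp_0 in I; exact I.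
Qed.

Section RobbinsSiegmund.
Variables (V Q g G : nat -> R).
Hypotheses (HV : forall n, 0 <= V n) (HQ : forall n, 0 <= Q n) (Hg : nnsum g) (HG : nnsum G).
Hypothesis HVS : forall n, V (S n) <= (1 + g n) * V n - Q n + G n.

(** Up to the errors [G], the quotient [V n / pprod g n] decreases; the induction uses the
    cross-multiplied form. The same [E] serves every starting index [n], which allows a restart at a
    late iterate. *)
Lemma quasi_decreasing_bound E n m : (forall n, pprod g n <= E) -> (n <= m)%nat ->
  V m <= E * (V n + (psum G m - psum G n)).
Proof.
  intros HE L; pose proof (proj1 Hg) as Pg; pose proof (proj1 HG) as PG.
  assert (H : V m * pprod g n <= pprod g m * (V n + (psum G m - psum G n))).
  { induction L as [|m L IH]; [lra|]; simpl.
    pose proof (pprod_ge1 g n Pg) as P1; pose proof (pprod_ge1 g m Pg) as P2.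
    pose proof (HVS m) as Hm; specialize (HQ m); pose proof (Pg m) as gm; pose proof (PG m) as Gm.
    assert (Pm : pprod g n <= pprod g m).
    { clear -L Pg; induction L as [|m L IH]; simpl; [lra|].
      pose proof (pprod_ge1 g m Pg); specialize (Pg m); nra. }
    apply Rle_trans with (((1 + g m) * V m + G m) * pprod g n).
    { apply Rmult_le_compat_r; lra. }
    apply Rle_trans with ((1 + g m) * (pprod g m * (V n + (psum G m - psum G n))) + pprod g m * G m).
    { rewrite Rmult_plus_distr_r, Rmult_assoc; apply Rplus_le_compat.
      - apply Rmult_le_compat_l; lra.
      - rewrite Rmult_comm; apply Rmult_le_compat_r; lra. }
    enough (0 <= pprod g m * g m * G m) by lra.
    apply Rmult_le_pos; auto; apply Rmult_le_pos; lra. }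
  pose proof (pprod_ge1 g n Pg) as P1; pose proof (HV m).
  pose proof (psum_mono G n m PG L) as P3; pose proof (HV n).
  apply Rle_trans with (V m * pprod g n); [nra|]; eapply Rle_trans; [apply H|].
  apply Rmult_le_compat_r; auto; lra.
Qed.

Lemma robbins_siegmund_bounded : exists D, 0 <= D /\ forall n, V n <= D.
Proof.
  destruct (pprod_bounded g Hg) as [E [E1 HE]]; destruct HG as [PG [C HC]].
  exists (E * (V O + C)); split.
  - specialize (HC O); simpl in HC; specialize (HV O); apply Rmult_le_pos; lra.
  - intros n; eapply Rle_trans; [apply (quasi_decreasing_bound E 0 n HE); lia|].
    apply Rmult_le_compat_l; [lra|]; simpl; specialize (HC n); lra.
Qed.

(** Boundedness of [V] turns the multiplicative perturbation into the additive summable one [F], and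
    [V n - psum F n] then decreases. *)
Lemma robbins_siegmund : nnsum Q /\ exists l, Un_cv V l.
Proof.
  destruct robbins_siegmund_bounded as [D [D0 HD]].
  set (F := fun n => D * g n + G n).
  assert (HF : nnsum F) by (apply nnsum_add; auto; apply nnsum_scal; auto).
  assert (HS : forall n, V (S n) <= V n - Q n + F n).
  { intros n; pose proof (HVS n); specialize (HD n); pose proof (proj1 Hg n); unfold F; nra. }
  pose proof HF as [PF [C HC]].
  assert (HW : forall n, V n + psum Q n <= V O + psum F n).
  { induction n as [|n IH]; simpl; [lra | specialize (HS n); lra]. }
  assert (NQ : nnsum Q).
  { split; auto; exists (V O + C); intros n; specialize (HW n); specialize (HC n); specialize (HV n); lra. }
  split; auto.
  destruct (nnsum_cv F HF) as [l1 H1].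
  destruct (decreasing_bounded_cv (fun n => V n - psum F n) (- C)) as [l2 H2].
  - intros n; simpl; specialize (HS n); specialize (HQ n); lra.
  - intros n; specialize (HC n); specialize (HV n); lra.
  - exists (l2 + l1); apply cv_ext with (fun n => (V n - psum F n) + psum F n); [intros; ring|].
    apply CV_plus; auto.
Qed.

End RobbinsSiegmund.

(** * Convergence in Hilbert spaces *)

Lemma choice_fun (X Y : Type) (P : X -> Y -> Prop) :
  (forall a, exists b, P a b) -> exists f, forall a, P a (f a).
Proof.
  intros H; exists (fun a => proj1_sig (constructive_indefinite_description _ (H a))).
  intros a; apply (proj2_sig (constructive_indefinite_description _ (H a))).
Qed.

Section Convergence.
Context {K : Hilbert}.
Implicit Types (x y z l : K) (u v : nat -> K).

Lemma cauchy_strong_cv u :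
  (forall e, 0 < e -> exists N, forall n m, (N <= n)%nat -> (n <= m)%nat -> norm (hsub (u n) (u m)) < e) ->
  exists l, strong_cv u l.
Proof.
  intros H; apply (hcomplete K u); intros e He; destruct (H e He) as [N HN]; exists N.
  intros m n Hm Hn; change (norm (hsub (u m) (u n)) < e).
  destruct (Nat.le_ge_cases m n); [apply HN; lia | rewrite norm_sub_sym; apply HN; lia].
Qed.

Lemma summable_increments_strong_cv u f :
  nnsum f -> (forall n, norm (hsub (u (S n)) (u n)) <= f n) -> exists l, strong_cv u l.
Proof.
  intros H Hu; apply cauchy_strong_cv; intros e He.
  destruct (nnsum_tail f e H He) as [N HN]; exists N; intros n m Hn Hm.
  apply Rle_lt_trans with (psum f m - psum f n); [ | apply HN; auto].
  clear HN; rewrite norm_sub_sym; induction Hm as [|m Hm IH]; simpl.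
  - replace (hsub (u n) (u n)) with (@hzero K) by vec; rewrite norm_zero; lra.
  - pose proof (norm_sub_triangle (u m) (u (S m)) (u n)); specialize (Hu m); lra.
Qed.

Lemma strong_cv_weak u l : strong_cv u l -> weak_cv u l.
Proof.
  intros H z; apply cv_abs_le with (fun n => norm z * norm (hsub (u n) l)); [apply cv_scal0, H|].
  intros n; rewrite <- inner_sub_l, Rmult_comm; apply inner_abs_le.
Qed.

Lemma weak_cv_unique u l l' : weak_cv u l -> weak_cv u l' -> l = l'.
Proof. intros H H'; apply inner_ext; intros z; eapply UL_sequence; [apply H | apply H']. Qed.

Lemma strong_cv_near u v l : strong_cv u l -> Un_cv (fun n => norm (hsub (v n) (u n))) 0 -> strong_cv v l.
Proof.
  intros H H'; eapply cv_le; [apply (cv_add0 _ _ H' H)|]; intros n; split; [apply norm_ge0|].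
  apply norm_sub_triangle.
Qed.

Lemma weak_cv_near u v l : weak_cv u l -> Un_cv (fun n => norm (hsub (v n) (u n))) 0 -> weak_cv v l.
Proof.
  intros H H' z; apply cv_shift0 with (1 := H z).
  apply cv_abs_le with (1 := cv_scal0 (norm z) _ H'); intros n.
  rewrite Rminus_0_r, <- inner_sub_l, Rmult_comm; apply inner_abs_le.
Qed.

(** Replaces moving test vectors by their strong limit; Opial's argument needs this because the
    metric varies with [n]. *)
Lemma inner_cv_bounded_strong u v l C a :
  (forall n, norm (u n) <= C) -> strong_cv v l -> Un_cv (fun n => hinner (u n) (v n)) a ->
  Un_cv (fun n => hinner (u n) l) a.
Proof.
  intros HC H Ha; apply cv_shift0 with (1 := Ha).
  apply cv_abs_le with (1 := cv_scal0 C _ H); intros n.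
  rewrite Rminus_0_r, <- inner_sub_r; eapply Rle_trans; [apply inner_abs_le|].
  rewrite norm_sub_sym; apply Rmult_le_compat_r; auto; apply norm_ge0.
Qed.

End Convergence.

(** * The product of two Hilbert spaces *)

Lemma sqrt_add_le a b : 0 <= a -> 0 <= b -> sqrt (a + b) <= sqrt a + sqrt b.
Proof.
  intros Ha Hb; pose proof (sqrt_pos a); pose proof (sqrt_pos b).
  apply Rsqr_incr_0_var; [ | lra]; unfold Rsqr; rewrite sqrt_sqrt by lra.
  pose proof (sqrt_sqrt a Ha); pose proof (sqrt_sqrt b Hb); nra.
Qed.

(** A single cluster point in the product provides limits of two sequences along the same
    indices. *)
Definition prodH (K L : Hilbert) : Hilbert.
Proof.
  refine {| hcar := K * L; hzero := (hzero, hzero);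
    hadd := fun x y => (hadd (fst x) (fst y), hadd (snd x) (snd y));
    hopp := fun x => (hopp (fst x), hopp (snd x));
    hscal := fun a x => (hscal a (fst x), hscal a (snd x));
    hinner := fun x y => hinner (fst x) (fst y) + hinner (snd x) (snd y) |}.
  all: try (intros; simpl; f_equal; vec; fail).
  - intros [x1 x2]; simpl; f_equal; vec.
  - intros [x1 x2]; simpl; f_equal; vec.
  - intros [x1 x2] [y1 y2]; simpl; rewrite (hinner_sym x1), (hinner_sym x2); ring.
  - intros [x1 x2] [y1 y2] [z1 z2]; simpl; inner_expand; ring.
  - intros a [x1 x2] [y1 y2]; simpl; inner_expand; ring.
  - intros [x1 x2]; simpl; pose proof (hinner_pos x1); pose proof (hinner_pos x2); lra.
  - intros [x1 x2]; simpl; intros H; pose proof (hinner_pos x1); pose proof (hinner_pos x2).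
    rewrite (hinner_def x1), (hinner_def x2) by lra; reflexivity.
  - intros u H; simpl in *.
    destruct (hcomplete K (fun n => fst (u n))) as [l1 H1].
    { intros e He; destruct (H e He) as [N HN]; exists N; intros m n Hm Hn.
      eapply Rle_lt_trans; [ | apply (HN m n Hm Hn)]; apply sqrt_le_1_alt.
      pose proof (hinner_pos (hadd (snd (u m)) (hopp (snd (u n))))); lra. }
    destruct (hcomplete L (fun n => snd (u n))) as [l2 H2].
    { intros e He; destruct (H e He) as [N HN]; exists N; intros m n Hm Hn.
      eapply Rle_lt_trans; [ | apply (HN m n Hm Hn)]; apply sqrt_le_1_alt.
      pose proof (hinner_pos (hadd (fst (u m)) (hopp (fst (u n))))); lra. }
    exists (l1, l2); simpl; eapply cv_le; [apply (cv_add0 _ _ H1 H2)|].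
    intros n; split; [apply sqrt_pos | apply sqrt_add_le; apply hinner_pos].
Defined.

(** * Weak cluster points *)

Section WeakCluster.
Context {K : Hilbert}.
Variables (P : nat -> Prop) (u : nat -> K) (C : R).
Hypothesis HP : forall n, exists k, (n <= k)%nat /\ P k.
Hypothesis HC : forall k, norm (u k) <= C.

(* The closed convex hull of the [u k] with [P k], [k >= n], as an intersection of half-spaces. *)
Definition hull n (w : K) :=
  forall z rho, (forall k, (n <= k)%nat -> P k -> hinner (u k) z <= rho) -> hinner w z <= rho.

Lemma hull_antitone n m w : (n <= m)%nat -> hull m w -> hull n w.
Proof. intros L H z rho Hk; apply H; intros k Lk; apply Hk; lia. Qed.

Lemma hull_midpoint n v w : hull n v -> hull n w -> hull n (hscal (/ 2) (hadd v w)).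
Proof.
  intros Hv Hw z rho Hk; inner_expand_all; specialize (Hv z rho Hk); specialize (Hw z rho Hk); lra.
Qed.

Lemma hull_min_norm n : exists d, (forall w, hull n w -> d <= hinner w w) /\
  forall e, 0 < e -> exists w, hull n w /\ hinner w w <= d + e.
Proof.
  destruct (completeness (fun s => exists w, hull n w /\ s = - hinner w w)) as [m [H1 H2]].
  - exists 0; intros s [w [_ ->]]; pose proof (hinner_pos w); lra.
  - destruct (HP n) as [k [Lk Pk]]; exists (- hinner (u k) (u k)), (u k); split; auto.
    intros z rho Hk; auto.
  - exists (- m); split.
    + intros w Hw; specialize (H1 (- hinner w w)); enough (- hinner w w <= m) by lra.
      apply H1; exists w; auto.
    + intros e He; apply NNPP; intros Hn; enough (m <= m - e) by lra.
      apply H2; intros s [w [Hw ->]]; apply Rnot_lt_le; intros Hl; apply Hn.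
      exists w; split; auto; lra.
Qed.

(* Approximate minimal-norm elements of the decreasing hulls form a Cauchy sequence. *)
Lemma weak_cluster : exists w, forall n, hull n w.
Proof.
  destruct (choice_fun _ _ _ hull_min_norm) as [d Hd].
  destruct (choice_fun nat K (fun n w => hull n w /\ hinner w w <= d n + / (INR n + 1))) as [w Hw].
  { intros n; apply (proj2 (Hd n)), Rinv_0_lt_compat; pose proof (pos_INR n); lra. }
  assert (dm : forall n m, (n <= m)%nat -> d n <= d m).
  { intros n m L; apply Rnot_lt_le; intros Hl.
    destruct (proj2 (Hd m) ((d n - d m) / 2)) as [v [Hv Hv']]; [lra|].
    pose proof (proj1 (Hd n) v (hull_antitone n m v L Hv)); lra. }
  destruct (growing_cv d) as [dl Hdl].
  { intros n; apply dm; lia. }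
  { exists (C ^ 2); intros s [n ->]; destruct (HP n) as [k [Lk Pk]].
    eapply Rle_trans; [apply (proj1 (Hd n) (u k))|]; [intros z rho Hk; auto | apply sq_le_norm, HC]. }
  destruct (cauchy_strong_cv w) as [l Hl].
  { intros e He.
    destruct (Hdl (e ^ 2 / 8)) as [N1 HN1]; [nra|].
    destruct (archimed_cor1 (e ^ 2 / 8)) as [N2 [HN2 PN2]]; [nra|].
    assert (I : forall n, (N2 <= n)%nat -> / (INR n + 1) < e ^ 2 / 8).
    { intros n Hn; apply le_INR in Hn; apply lt_0_INR in PN2.
      eapply Rle_lt_trans; [ | apply HN2]; apply Rinv_le_contravar; lra. }
    exists (max N1 N2); intros n m Ln Lm.
    assert (Q : hinner (hsub (w n) (w m)) (hsub (w n) (w m)) < e ^ 2).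
    { destruct (Hw n) as [Hn Qn]; destruct (Hw m) as [Hm Qm].
      (* The midpoint of [w n] and [w m] lies in [hull n], so its squared norm is at least [d n].
         The parallelogram law bounds the squared distance by [2 (d m - d n) + 2 / (n + 1) + 2 / (m
         + 1)], which is below [e ^ 2] by the choice of [e ^ 2 / 8]. *)
      pose proof (proj1 (Hd n) _ (hull_midpoint n _ _ Hn (hull_antitone n m _ Lm Hm))) as Qp.
      pose proof (HN1 n ltac:(lia)) as D1; pose proof (HN1 m ltac:(lia)) as D2.
      pose proof (I n ltac:(lia)) as I1; pose proof (I m ltac:(lia)) as I2.
      unfold Rdist in *; revert Qp; inner_expand_all; rewrite (hinner_sym (w m) (w n)); intros Qp.
      apply Rabs_def2 in D1; apply Rabs_def2 in D2.
      pose proof (dm n m Lm); lra. }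
    rewrite <- norm_sq in Q; pose proof (norm_ge0 (hsub (w n) (w m))).
    apply Rnot_le_lt; intro; nra. }
  exists l; intros n z rho Hk.
  apply Rnot_lt_le; intros Hlt.
  destruct (strong_cv_weak w l Hl z (hinner l z - rho)) as [N HN]; [lra|].
  specialize (HN (max n N) ltac:(lia)); unfold Rdist in HN; apply Rabs_def2 in HN.
  pose proof (hull_antitone n (max n N) _ ltac:(lia) (proj1 (Hw (max n N))) z rho Hk); lra.
Qed.

(** Late hulls lie in thin slabs around the limit. The limit does not depend on [P], so cluster
    points taken along different index sets become comparable. *)
Lemma hull_limit w z a : (forall n, hull n w) -> Un_cv (fun n => hinner (u n) z) a -> hinner w z = a.
Proof.
  intros Hw H; apply Rle_antisym; apply Rnot_lt_le; intros L.
  - destruct (H ((hinner w z - a) / 2)) as [N HN]; [lra|].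
    pose proof (Hw N z ((a + hinner w z) / 2)) as E; enough (hinner w z <= (a + hinner w z) / 2) by lra.
    apply E; intros k Lk _; specialize (HN k Lk); apply Rabs_def2 in HN; lra.
  - destruct (H ((a - hinner w z) / 2)) as [N HN]; [lra|].
    pose proof (Hw N (hopp z) (- ((a + hinner w z) / 2))) as E; rewrite inner_opp_r in E.
    enough (- hinner w z <= - ((a + hinner w z) / 2)) by lra.
    apply E; intros k Lk _; rewrite inner_opp_r; specialize (HN k Lk); apply Rabs_def2 in HN; lra.
Qed.

End WeakCluster.

(** * Positive self-adjoint operators *)

Section Operators.
Context {K : Hilbert}.
Implicit Types (M T : K -> K) (v w x : K).

(** The linear part of [is_bounded_linear]; bounds are carried separately, with explicit
    constants. *)
Definition is_linear M := (forall v w, M (hadd v w) = hadd (M v) (M w)) /\ (forall a v, M (hscal a v) = hscal a (M v)).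

Lemma linear_sub M v w : is_linear M -> M (hsub v w) = hsub (M v) (M w).
Proof.
  intros [Ha Hs]; replace (hsub v w) with (hadd v (hscal (-1) w)) by vec.
  rewrite Ha, Hs; vec.
Qed.

Lemma quad_add M v w : is_linear M -> self_adjoint M ->
  hinner (M (hadd v w)) (hadd v w) = hinner (M v) v + 2 * hinner (M v) w + hinner (M w) w.
Proof. intros [Ha Hs] S; rewrite Ha; inner_expand_all; rewrite (S w v), (hinner_sym w); ring. Qed.

Lemma quad_scal M a v : is_linear M -> hinner (M (hscal a v)) (hscal a v) = a ^ 2 * hinner (M v) v.
Proof. intros [Ha Hs]; rewrite Hs; inner_expand_all; ring. Qed.

Lemma quad_sub M v w : is_linear M -> self_adjoint M ->
  hinner (M (hsub v w)) (hsub v w) = hinner (M v) v - 2 * hinner (M v) w + hinner (M w) w.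
Proof. intros L S; rewrite linear_sub by auto; inner_expand_all; rewrite (S w v), (hinner_sym w); ring. Qed.

(** Lax-Milgram by the iteration [t (S n) = t n + s (z - M (t n))]. The increments [d n] are
    multiplied by [Id - s M], a contraction for small [s], and [z - M (t n) = d n / s] tends to
    0. *)
Lemma coercive_surjective M alpha c z : is_linear M -> 0 < alpha -> alpha <= c ->
  (forall v, norm (M v) <= c * norm v) -> (forall v, alpha * hinner v v <= hinner (M v) v) ->
  exists v, M v = z.
Proof.
  intros L Ha Hc Hb Hl.
  set (s := alpha / c ^ 2).
  set (t := fix t n := match n with O => hzero | S n => hadd (t n) (hscal s (hsub z (M (t n)))) end : hcar K).
  set (d := fun n => hsub (t (S n)) (t n)).
  (* The value [s = alpha / c ^ 2] minimizes [1 - 2 s alpha + s ^ 2 c ^ 2], which bounds the square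
     of the norm of [Id - s M]. The minimum is [1 - 2 k <= (1 - k) ^ 2]. *)
  set (k := alpha ^ 2 / (2 * c ^ 2)).
  assert (Hk : 0 < k <= / 2).
  { unfold k; split; [apply Rdiv_lt_0_compat; nra|].
    apply Rmult_le_reg_l with (2 * c ^ 2); [nra|].
    replace (2 * c ^ 2 * (alpha ^ 2 / (2 * c ^ 2))) with (alpha ^ 2) by (field; lra); nra. }
  assert (Hs : 0 < s) by (apply Rdiv_lt_0_compat; nra).
  assert (Ed : forall n, d (S n) = hsub (d n) (hscal s (M (d n)))).
  { intros n; unfold d; rewrite linear_sub by auto; simpl; vec. }
  assert (Nd : forall n, norm (d (S n)) <= (1 - k) * norm (d n)).
  { intros n; pose proof (norm_ge0 (d n)).
    apply norm_le_sq; [nra|]; rewrite Ed; inner_expand_all.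
    rewrite (hinner_sym (d n) (M (d n))); pose proof (sq_le_norm _ _ (Hb (d n))) as B.
    pose proof (Hl (d n)) as A.
    replace ((c * norm (d n)) ^ 2) with (c ^ 2 * hinner (d n) (d n)) in B by (rewrite <- norm_sq; ring).
    replace (((1 - k) * norm (d n)) ^ 2) with ((1 - k) ^ 2 * hinner (d n) (d n)) by (rewrite <- norm_sq; ring).
    assert (E1 : s * alpha = 2 * k) by (unfold s, k; field; lra).
    assert (E2 : s * (s * c ^ 2) = 2 * k).
    { unfold s, k; field; lra. }
    assert (B' : s * (s * hinner (M (d n)) (M (d n))) <= 2 * k * hinner (d n) (d n)).
    { rewrite <- E2, Rmult_assoc, Rmult_assoc; do 2 (apply Rmult_le_compat_l; [lra|]); exact B. }
    assert (A' : 2 * k * hinner (d n) (d n) <= s * hinner (M (d n)) (d n)).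
    { rewrite <- E1, Rmult_assoc; apply Rmult_le_compat_l; [lra|]; exact A. }
    pose proof (hinner_pos (d n)); nra. }
  assert (Sd : nnsum (fun n => norm (d n))).
  { split; [intros; apply norm_ge0|]; exists (/ k * norm (d O)); intros n.
    assert (I : k * psum (fun n => norm (d n)) n + norm (d n) <= norm (d O)).
    { induction n as [|n IH]; simpl psum; [lra|]; specialize (Nd n); lra. }
    apply Rmult_le_reg_l with k; [lra|]; rewrite <- Rmult_assoc, Rinv_r by lra.
    pose proof (norm_ge0 (d n)); lra. }
  destruct (summable_increments_strong_cv t (fun n => norm (d n)) Sd) as [v Hv].
  { intros n; apply Rle_refl. }
  exists v; apply (weak_cv_unique (fun n => M (t n))); apply strong_cv_weak.
  - eapply cv_le; [apply (cv_scal0 c _ Hv)|]; intros n; split; [apply norm_ge0|].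
    rewrite <- linear_sub by auto; apply Hb.
  - eapply cv_le; [apply (cv_scal0 (/ s) _ (nnsum_cv0 _ Sd))|]; intros n; split; [apply norm_ge0|].
    replace (hsub (M (t n)) z) with (hscal (- / s) (d n)).
    2: { unfold d; simpl; vec; field; lra. }
    rewrite norm_scal, Rabs_Ropp, Rabs_pos_eq; [apply Rle_refl|].
    apply Rlt_le, Rinv_0_lt_compat, Hs.
Qed.

(** The form of [M] is nonnegative at [v - M v / C]; the upper bound at [M v] absorbs half of the
    cross term. *)
Lemma positive_norm_sq_le M C v : is_linear M -> self_adjoint M -> 0 < C ->
  (forall h, 0 <= hinner (M h) h <= C * hinner h h) -> hinner (M v) (M v) <= C * hinner (M v) v.
Proof.
  intros L S HC H.
  pose proof (proj1 (H (hsub v (hscal (/ C) (M v))))) as P.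
  rewrite quad_sub, quad_scal, inner_scal_r in P by auto.
  pose proof (proj2 (H (M v))) as B.
  assert (B' : (/ C) ^ 2 * hinner (M (M v)) (M v) <= (/ C) ^ 2 * (C * hinner (M v) (M v))).
  { apply Rmult_le_compat_l; auto; apply pow2_ge_0. }
  replace ((/ C) ^ 2 * (C * hinner (M v) (M v))) with (/ C * hinner (M v) (M v)) in B' by (field; lra).
  apply Rmult_le_reg_l with (/ C); [apply Rinv_0_lt_compat, HC|].
  rewrite <- Rmult_assoc, Rinv_l by lra; lra.
Qed.

(** For [n <= m] the difference [M n - M m] lies between 0 and [2 C], so [positive_norm_sq_le]
    reduces the Cauchy property of the vectors to that of the numbers [<M n v, v>]. The two-sided
    bound lets the lemma apply to negatives of positive operators too. *)
Lemma monotone_operators_cv (M : nat -> K -> K) C v :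
  (forall n, is_linear (M n)) -> (forall n, self_adjoint (M n)) -> 0 < C ->
  (forall n h, Rabs (hinner (M n h) h) <= C * hinner h h) ->
  (forall n h, hinner (M (S n) h) h <= hinner (M n h) h) ->
  exists g, strong_cv (fun n => M n v) g.
Proof.
  intros L S HC HB HM.
  assert (HM' : forall n m h, (n <= m)%nat -> hinner (M m h) h <= hinner (M n h) h).
  { intros n m h Lm; induction Lm as [|m Lm IH]; [lra|]; specialize (HM m h); lra. }
  destruct (decreasing_bounded_cv (fun n => hinner (M n v) v) (- (C * hinner v v))) as [l Hl].
  { intros n; apply HM. }
  { intros n; pose proof (HB n v) as H; apply Rabs_le_inv in H; lra. }
  apply cauchy_strong_cv; intros e He.
  destruct (Hl (e ^ 2 / (4 * C))) as [N HN]; [apply Rdiv_lt_0_compat; nra|].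
  exists N; intros n m Hn Hm.
  assert (P : hinner (hsub (M n v) (M m v)) (hsub (M n v) (M m v)) <= 2 * C * hinner (hsub (M n v) (M m v)) v).
  { apply (positive_norm_sq_le (fun h => hsub (M n h) (M m h))); [ | | lra | ].
    - destruct (L n) as [A1 A2]; destruct (L m) as [B1 B2]; split; intros; rewrite ?A1, ?B1, ?A2, ?B2; vec.
    - intros a b; inner_expand; rewrite (S n a b), (S m a b); reflexivity.
    - intros h; inner_expand; specialize (HM' n m h Hm).
      pose proof (HB n h) as H1; pose proof (HB m h) as H2.
      apply Rabs_le_inv in H1; apply Rabs_le_inv in H2; lra. }
  pose proof (HN n Hn) as H1; pose proof (HN m ltac:(lia)) as H2.
  apply Rabs_def2 in H1; apply Rabs_def2 in H2.
  rewrite <- norm_sq, inner_sub_l in P; pose proof (norm_ge0 (hsub (M n v) (M m v))).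
  assert (Q : 2 * C * (hinner (M n v) v - hinner (M m v) v) < 2 * C * (2 * (e ^ 2 / (4 * C)))).
  { apply Rmult_lt_compat_l; lra. }
  replace (2 * C * (2 * (e ^ 2 / (4 * C)))) with (e ^ 2) in Q by (field; lra).
  apply Rnot_le_lt; intro; nra.
Qed.

(** [M] is known only as a right inverse, chosen pointwise; coercivity makes [T] injective, and this
    forces linearity. *)
Lemma inverse_linear T M alpha : is_linear T -> 0 < alpha ->
  (forall v, alpha * hinner v v <= hinner (T v) v) -> (forall v, T (M v) = v) -> is_linear M.
Proof.
  intros L Ha H E.
  assert (I : forall v w, T v = T w -> v = w).
  { intros v w Hvw; specialize (H (hsub v w)).
    rewrite linear_sub, Hvw in H by auto.
    replace (hsub (T w) (T w)) with (@hzero K) in H by vec; rewrite inner_zero_l in H.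
    assert (Z : hsub v w = hzero).
    { apply inner_self_le0; pose proof (hinner_pos (hsub v w)); nra. }
    replace v with (hadd w (hsub v w)) by vec; rewrite Z; vec. }
  split; intros; apply I.
  - rewrite (proj1 L), !E; reflexivity.
  - rewrite (proj2 L), !E; reflexivity.
Qed.

Lemma inverse_self_adjoint T M : self_adjoint T -> (forall v, T (M v) = v) -> self_adjoint M.
Proof. intros S E v w; rewrite <- (E w) at 1; rewrite <- S, E; reflexivity. Qed.

(** Inversion reverses the order: expand the nonnegative form of [T'] at [M' v - M v / c] and bound
    its last term through [T]. The factor [c] is 1 for the decrease of the metrics and [1 + nu n] in
    case (d). *)
Lemma inverse_order T T' M M' c : is_linear T' -> self_adjoint T' ->
  (forall v, 0 <= hinner (T' v) v) ->
  (forall v, T (M v) = v) -> (forall v, T' (M' v) = v) -> 0 < c ->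
  (forall v, hinner (T' v) v <= c * hinner (T v) v) ->
  forall v, hinner (M v) v <= c * hinner (M' v) v.
Proof.
  intros L S P E E' Hc H v.
  pose proof (P (hsub (M' v) (hscal (/ c) (M v)))) as Q.
  rewrite quad_sub, quad_scal, inner_scal_r, E', (hinner_sym v (M' v)), (hinner_sym v (M v)) in Q by auto.
  pose proof (H (M v)) as B; rewrite E, (hinner_sym v) in B.
  assert (B' : (/ c) ^ 2 * hinner (T' (M v)) (M v) <= (/ c) ^ 2 * (c * hinner (M v) v)).
  { apply Rmult_le_compat_l; auto; apply pow2_ge_0. }
  replace ((/ c) ^ 2 * (c * hinner (M v) v)) with (/ c * hinner (M v) v) in B' by (field; lra).
  apply Rmult_le_reg_l with (/ c); [apply Rinv_0_lt_compat, Hc|].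
  rewrite <- Rmult_assoc, Rinv_l by lra; lra.
Qed.

(* [2 <M v, w> <= g <M v, v> + <M w, w> / g]; at [g = 0] the hypothesis forces [w = 0]. *)
Lemma quad_perturb M k C g v w : is_linear M -> self_adjoint M -> 0 < k ->
  (forall h, k * hinner h h <= hinner (M h) h) -> 0 <= g -> hinner (M w) w <= C * g ^ 2 ->
  hinner (M (hadd v w)) (hadd v w) <= (1 + g) * hinner (M v) v + C * (g + g ^ 2).
Proof.
  intros L S Hk H Hg Hw; rewrite quad_add by auto.
  assert (I : 2 * hinner (M v) w <= g * hinner (M v) v + C * g).
  { destruct (Req_dec g 0) as [->|Z].
    - rewrite (inner_self_le0 w); [rewrite inner_zero_r; lra|].
      specialize (H w); pose proof (hinner_pos w); nra.
    - pose proof (H (hsub (hscal g v) w)) as P; rewrite quad_sub, quad_scal in P by auto.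
      rewrite (proj2 L), hinner_scal_l in P.
      pose proof (hinner_pos (hsub (hscal g v) w)).
      apply Rmult_le_reg_l with g; [lra|]; nra. }
  lra.
Qed.

End Operators.

(** * One step of the algorithm *)

Section Step.
Context {K : Hilbert}.
Variables (A : setop K) (B T M : K -> K) (beta m eps d : R) (x a r u z : K).
Hypotheses (LT : is_linear T) (LM : is_linear M) (SM : self_adjoint M) (ST : self_adjoint T).
Hypothesis TM : forall v, T (M v) = v.
Hypothesis M_pos : forall v, 0 <= hinner (M v) v.
Hypothesis M_low : forall v, hinner v v <= m * hinner (M v) v.
Hypothesis T_up : forall v, hinner (T v) v <= m * hinner v v.
Hypotheses (A_mon : monotone A) (B_mon : single_monotone B) (B_lip : lipschitz beta B).
Hypotheses (Hm : 0 < m) (Hbeta : 0 < beta) (Hd : 0 <= d) (Heps : 0 < eps < 1) (Hstep : d * beta * m <= 1 - eps).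
Hypotheses (Hz : zer (op_sum A B) z) (Hu : A r u).
Hypothesis Hr : hsub x (hscal d (T (hadd (B x) a))) = hadd r (hscal d (T u)).

Lemma inverse_left v : M (T v) = v.
Proof. apply inner_ext; intros w; rewrite SM, ST, TM; reflexivity. Qed.

Lemma quad_image v : hinner (M (hscal d (T v))) (hscal d (T v)) = d ^ 2 * hinner (T v) v.
Proof. rewrite quad_scal, inverse_left, (hinner_sym v) by auto; reflexivity. Qed.

Lemma lipschitz_sq v w : hinner (hsub (B v) (B w)) (hsub (B v) (B w)) <= beta ^ 2 * hinner (hsub v w) (hsub v w).
Proof.
  eapply Rle_trans; [apply sq_le_norm, B_lip|]; rewrite <- norm_sq; apply Req_le; ring.
Qed.

Lemma zer_monotone : 0 <= hinner (hsub r z) (hadd u (B r)).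
Proof.
  destruct Hz as [w [Aw Ew]].
  pose proof (A_mon r z u w Hu Aw) as H1.
  pose proof (B_mon r z (B r) (B z) eq_refl eq_refl) as H2.
  assert (E : hinner (hsub r z) (hadd w (B z)) = 0) by (rewrite <- Ew; apply inner_zero_r).
  rewrite inner_sub_r in H1, H2; rewrite inner_add_r in E |- *; lra.
Qed.

(** Once the error [a] is moved into the starting point, the displacement of the step is [d T]
    applied to [u + B r], an element of [(A + B) r]. Both the sign in [fbf_descent] and the decay of
    [u + B r] rest on this. *)
Lemma step_residual :
  hsub (hsub x (hscal d (T a))) (hadd r (hscal d (T (hsub (B x) (B r))))) = hscal d (T (hadd u (B r))).
Proof.
  apply inner_ext; intros w.
  assert (E : hinner (hsub x (hscal d (T (hadd (B x) a)))) w = hinner (hadd r (hscal d (T u))) w)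
    by (rewrite Hr; reflexivity).
  revert E; rewrite linear_sub, !(proj1 LT) by auto; inner_expand_all; lra.
Qed.

(** Tseng's estimate in the metric [M]. The three-point identity involves [X - r], with [X = x - e],
    whereas the Lipschitz bound involves [x - r]; the last term pays for the difference [e]. *)
Lemma fbf_descent :
  let t := hadd r (hscal d (T (hsub (B x) (B r)))) in
  let e := hscal d (T a) in
  hinner (M (hsub t z)) (hsub t z) <=
    hinner (M (hsub (hsub x e) z)) (hsub (hsub x e) z)
    - eps / 2 * hinner (M (hsub x r)) (hsub x r) + (2 + / eps) * hinner (M e) e.
Proof.
  intros t e; set (X := hsub x e).
  pose proof step_residual as HR; fold t e X in HR.
  assert (H1 : hinner (M (hsub t z)) (hsub t z) = hinner (M (hsub X z)) (hsub X z)
     - hinner (M (hsub X r)) (hsub X r) + hinner (M (hsub t r)) (hsub t r)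
     - 2 * hinner (M (hsub X t)) (hsub r z)).
  { replace (hsub X z) with (hadd (hsub X t) (hadd (hsub t r) (hsub r z))) by vec.
    replace (hsub X r) with (hadd (hsub X t) (hsub t r)) by vec.
    replace (hsub t z) with (hadd (hsub t r) (hsub r z)) by vec.
    rewrite !(quad_add M (hsub X t)), !(quad_add M (hsub t r)), inner_add_r by auto; ring. }
  assert (H2 : 0 <= hinner (M (hsub X t)) (hsub r z)).
  { rewrite HR, (proj2 LM), inverse_left, hinner_scal_l, hinner_sym.
    apply Rmult_le_pos; auto; apply zer_monotone. }
  (* The left side is [d ^ 2 <T h, h>] with [h = B x - B r]; the bounds on [T], [B] and [M] together
     give the factor [(d beta m) ^ 2]. *)
  assert (H3 : hinner (M (hsub t r)) (hsub t r) <= (1 - eps) ^ 2 * hinner (M (hsub x r)) (hsub x r)).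
  { replace (hsub t r) with (hscal d (T (hsub (B x) (B r)))) by (unfold t; vec).
    rewrite quad_image.
    pose proof (T_up (hsub (B x) (B r))) as E1; pose proof (lipschitz_sq x r) as E2.
    pose proof (M_low (hsub x r)) as E3; pose proof (M_pos (hsub x r)) as E4.
    assert (I1 : hinner (T (hsub (B x) (B r))) (hsub (B x) (B r)) <= m * (beta ^ 2 * (m * hinner (M (hsub x r)) (hsub x r)))).
    { eapply Rle_trans; [apply E1|]; apply Rmult_le_compat_l; [lra|].
      eapply Rle_trans; [apply E2|]; apply Rmult_le_compat_l; [nra|]; exact E3. }
    apply Rle_trans with (d ^ 2 * (m * (beta ^ 2 * (m * hinner (M (hsub x r)) (hsub x r))))).
    { apply Rmult_le_compat_l; [nra|]; exact I1. }
    replace (d ^ 2 * (m * (beta ^ 2 * (m * hinner (M (hsub x r)) (hsub x r)))))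
      with ((d * beta * m) ^ 2 * hinner (M (hsub x r)) (hsub x r)) by ring.
    apply Rmult_le_compat_r; auto; apply pow_incr; split; auto.
    repeat apply Rmult_le_pos; lra. }
  assert (Ex : hsub x r = hadd (hsub X r) e) by (unfold X; vec).
  (* Young's inequality for [x - r = (X - r) + e]. The choice [s = eps] is small enough for
     [(1 - eps) ^ 2 (1 + eps) <= 1 - eps]; the choice [s = 1] converts the remaining [eps] times the
     square of [X - r] into [eps / 2] times that of [x - r]. *)
  assert (H4 : forall s, 0 < s -> hinner (M (hsub x r)) (hsub x r) <=
    (1 + s) * hinner (M (hsub X r)) (hsub X r) + (1 + / s) * hinner (M e) e).
  { intros s Hs; rewrite Ex, quad_add by auto.
    pose proof (M_pos (hsub (hscal s (hsub X r)) e)) as P.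
    rewrite quad_sub, quad_scal, (proj2 LM), hinner_scal_l in P by auto.
    enough (2 * hinner (M (hsub X r)) e <= s * hinner (M (hsub X r)) (hsub X r) + / s * hinner (M e) e) by lra.
    apply Rmult_le_reg_l with s; auto.
    rewrite Rmult_plus_distr_l, <- (Rmult_assoc s (/ s)), Rinv_r by lra; lra. }
  pose proof (H4 eps ltac:(lra)) as H5; pose proof (H4 1 ltac:(lra)) as H6.
  rewrite Rinv_1 in H6.
  pose proof (M_pos (hsub X r)) as PX; pose proof (M_pos e) as Pe; pose proof (M_pos (hsub x r)) as Px.
  fold X in H1, H2, H3, H4, H5, H6, PX |- *.
  assert (Pi : 1 < / eps) by (rewrite <- Rinv_1; apply Rinv_lt_contravar; lra).
  assert (H7 : (1 - eps) ^ 2 * hinner (M (hsub x r)) (hsub x r) <=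
    (1 - eps) * hinner (M (hsub X r)) (hsub X r) + (1 + / eps) * hinner (M e) e).
  { apply Rle_trans with ((1 - eps) ^ 2 * ((1 + eps) * hinner (M (hsub X r)) (hsub X r) + (1 + / eps) * hinner (M e) e)).
    - apply Rmult_le_compat_l; auto; apply pow2_ge_0.
    - rewrite Rmult_plus_distr_l; apply Rplus_le_compat.
      + rewrite <- Rmult_assoc; apply Rmult_le_compat_r; auto; nra.
      + rewrite <- Rmult_assoc; apply Rmult_le_compat_r; auto.
        rewrite <- (Rmult_1_l (1 + / eps)) at 2; apply Rmult_le_compat_r; [lra|nra]. }
  assert (H8 : eps / 2 * hinner (M (hsub x r)) (hsub x r) <= eps * hinner (M (hsub X r)) (hsub X r) + eps * hinner (M e) e) by nra.
  assert (H9 : eps * hinner (M e) e <= hinner (M e) e) by nra.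
  lra.
Qed.

End Step.

(** * Infima and lower limits of distances *)

Lemma glb_exists (E : R -> Prop) (l s : R) : (forall t, E t -> l <= t) -> E s -> exists m, is_glb E m.
Proof.
  intros Hl Hs; destruct (completeness (fun t => E (- t))) as [m [H1 H2]].
  - exists (- l); intros t Ht; specialize (Hl _ Ht); lra.
  - exists (- s); rewrite Ropp_involutive; exact Hs.
  - exists (- m); split.
    + intros t Ht; enough (- t <= m) by lra; apply H1; rewrite Ropp_involutive; exact Ht.
    + intros k Hk; enough (m <= - k) by lra; apply H2; intros t Ht; specialize (Hk _ Ht); lra.
Qed.

(** If all distances from [N] on were at least [e], so would be their infimum. [liminf_is] only
    speaks of tail infima that exist, hence the appeal to [glb_exists]. *)
Lemma liminf_dist_zero (K : Hilbert) (C : K -> Prop) (x : nat -> K) (d : nat -> R) :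
  (forall n, dist_is C (x n) (d n)) -> liminf_is d 0 ->
  forall e N, 0 < e -> exists n z, (N <= n)%nat /\ C z /\ norm (hsub (x n) z) < e.
Proof.
  intros Hd [Hl _] e N He.
  destruct (glb_exists (fun t => exists n, (n >= N)%nat /\ t = d n) 0 (d N)) as [s Hs].
  { intros t [n [_ ->]]; apply (Hd n); intros t' [z [_ ->]]; apply norm_ge0. }
  { exists N; auto. }
  apply NNPP; intros Hn; enough (e <= 0) by lra.
  apply Rle_trans with s; [ | apply Hl; exists N; exact Hs].
  apply Hs; intros t [n [Ln ->]]; apply (Hd n); intros t' [z [Cz ->]].
  apply Rnot_lt_le; intros L; apply Hn; exists n, z; auto.
Qed.

(** * The sequence of iterates *)

Section Iterates.
Context {K : Hilbert}.
Variables (A : setop K) (B : K -> K) (T M : nat -> K -> K) (d m : nat -> R).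
Variables (alpha beta mb C1 eps dlo : R) (x r u a b c : nat -> K).
Hypothesis LT : forall n, is_linear (T n).
Hypothesis ST : forall n, self_adjoint (T n).
Hypothesis TM : forall n v, T n (M n v) = v.
Hypothesis T_low : forall n v, alpha * hinner v v <= hinner (T n v) v.
Hypothesis T_up : forall n v, norm (T n v) <= mb * norm v.
Hypothesis T_mono : forall n v, hinner (T n v) v <= hinner (T (S n) v) v.
Hypotheses (Halpha : 0 < alpha) (Hmb : 0 < mb) (Hbeta : 0 < beta) (Heps : 0 < eps < 1) (Hdlo : 0 < dlo) (HC1 : 0 <= C1).
Hypothesis Hd : forall n, dlo <= d n.
(** Two upper bounds on [T n] coexist: [mb] is uniform, while [m n] varies so that
    [d n * beta * m n] keeps the margin [eps], which [mb] in its place could destroy. *)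
Hypothesis Hm : forall n, 0 < m n.
Hypothesis T_m : forall n v, hinner (T n v) v <= m n * hinner v v.
Hypothesis Hstep : forall n, d n * beta * m n <= 1 - eps.
Hypothesis HdT : forall n v, d n * norm (T n v) <= C1 * norm v.
Hypotheses (A_max : maximally_monotone A) (B_mon : single_monotone B) (B_lip : lipschitz beta B).
Hypothesis Hzer : exists z, zer (op_sum A B) z.
Hypothesis Hg : nnsum (fun n => norm (a n) + norm (b n) + norm (c n)).
Hypothesis Hu : forall n, A (r n) (u n).
Hypothesis Hr : forall n, hsub (x n) (hscal (d n) (T n (hadd (B (x n)) (a n)))) = hadd (r n) (hscal (d n) (T n (u n))).
Hypothesis Hx : forall n, x (S n) = hadd (hadd (r n) (b n))
  (hscal (d n) (T n (hadd (hsub (B (x n)) (B (hadd (r n) (b n)))) (hsub (a n) (c n))))).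

Let g n := norm (a n) + norm (b n) + norm (c n).
Let Z := zer (op_sum A B).
Let V z n := hinner (M n (hsub (x n) z)) (hsub (x n) z).

(** * Bounds on the inverse metrics *)

Lemma M_linear n : is_linear (M n).
Proof. apply inverse_linear with (T n) alpha; auto. Qed.

Lemma M_sa n : self_adjoint (M n).
Proof. apply inverse_self_adjoint with (T n); auto. Qed.

Lemma T_pos n v : 0 <= hinner (T n v) v.
Proof. pose proof (T_low n v); pose proof (hinner_pos v); nra. Qed.

Lemma T_le_mb n v : hinner (T n v) v <= mb * hinner v v.
Proof.
  eapply Rle_trans; [apply inner_le_norm|]; rewrite <- norm_sq.
  pose proof (T_up n v); pose proof (norm_ge0 v); nra.
Qed.

(** The constant is free because the lemma serves both with [mb] and with [m n]. *)
Lemma M_low_of k n v : 0 < k -> (forall h, hinner (T n h) h <= k * hinner h h) ->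
  hinner v v <= k * hinner (M n v) v.
Proof.
  intros Hk H; rewrite <- (TM n v) at 1 2 4; rewrite (hinner_sym (M n v)).
  apply positive_norm_sq_le; auto; intros h; split; auto; apply T_pos.
Qed.

Lemma M_low n v : hinner v v <= mb * hinner (M n v) v.
Proof. apply M_low_of; auto; apply T_le_mb. Qed.

Lemma M_pos n v : 0 <= hinner (M n v) v.
Proof. pose proof (M_low n v); pose proof (hinner_pos v); nra. Qed.

Lemma M_coercive n v : / mb * hinner v v <= hinner (M n v) v.
Proof.
  pose proof (M_low n v); apply Rmult_le_reg_l with mb; auto.
  rewrite <- Rmult_assoc, Rinv_r; lra.
Qed.

Lemma M_up n v : hinner (M n v) v <= / alpha * hinner v v.
Proof.
  pose proof (hinner_pos (hsub v (hscal alpha (M n v)))) as P.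
  pose proof (T_low n (M n v)) as L; rewrite TM, (hinner_sym v) in L.
  revert P; inner_expand_all; rewrite (hinner_sym v (M n v)); intros P.
  apply Rmult_le_reg_l with alpha; auto; rewrite <- Rmult_assoc, Rinv_r by lra; nra.
Qed.

Lemma M_up_norm n v k : norm v <= k -> hinner (M n v) v <= / alpha * k ^ 2.
Proof.
  intros H; eapply Rle_trans; [apply M_up|]; apply Rmult_le_compat_l.
  - apply Rlt_le, Rinv_0_lt_compat, Halpha.
  - apply sq_le_norm, H.
Qed.

Lemma M_antitone n v : hinner (M (S n) v) v <= hinner (M n v) v.
Proof.
  rewrite <- (Rmult_1_l (hinner (M n v) v)); revert v.
  apply inverse_order with (T (S n)) (T n); auto; try lra; [intros; apply T_pos|].
  intros v; rewrite Rmult_1_l; auto.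
Qed.

(** * Quasi-Fejer monotonicity and summable residuals *)

Lemma d_pos n : 0 < d n.
Proof. specialize (Hd n); lra. Qed.

Lemma g_parts n : 0 <= norm (a n) <= g n /\ 0 <= norm (b n) <= g n /\ 0 <= norm (c n) <= g n.
Proof.
  unfold g; pose proof (norm_ge0 (a n)); pose proof (norm_ge0 (b n)); pose proof (norm_ge0 (c n)); lra.
Qed.

Lemma dT_norm n v : norm (hscal (d n) (T n v)) <= C1 * norm v.
Proof. pose proof (d_pos n); rewrite norm_scal, Rabs_pos_eq by lra; apply HdT. Qed.

(** Compares the true iterate with the point [t] of [fbf_descent]. The error [a n] occurs again here
    because the update subtracts [y n], which contains it. *)
Lemma error_norm n :
  norm (hsub (x (S n)) (hadd (r n) (hscal (d n) (T n (hsub (B (x n)) (B (r n))))))) <= (1 + C1 * beta + C1) * g n.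
Proof.
  replace (hsub (x (S n)) (hadd (r n) (hscal (d n) (T n (hsub (B (x n)) (B (r n)))))))
    with (hadd (b n) (hscal (d n) (T n (hadd (hsub (B (r n)) (B (hadd (r n) (b n)))) (hsub (a n) (c n)))))).
  2: { rewrite Hx; vec; rewrite !(proj1 (LT n)), !(fun v w => linear_sub (T n) v w (LT n)); inner_expand_all; ring. }
  eapply Rle_trans; [apply norm_add|].
  pose proof (dT_norm n (hadd (hsub (B (r n)) (B (hadd (r n) (b n)))) (hsub (a n) (c n)))) as H1.
  pose proof (norm_add (hsub (B (r n)) (B (hadd (r n) (b n)))) (hsub (a n) (c n))) as H2.
  pose proof (B_lip (r n) (hadd (r n) (b n))) as H3.
  replace (hsub (r n) (hadd (r n) (b n))) with (hopp (b n)) in H3 by vec; rewrite norm_opp in H3.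
  pose proof (norm_sub (a n) (c n)) as H4.
  assert (H5 : norm (hadd (hsub (B (r n)) (B (hadd (r n) (b n)))) (hsub (a n) (c n))) <= beta * g n + g n).
  { pose proof (g_parts n) as [Ga [Gb Gc]].
    assert (beta * norm (b n) <= beta * g n) by (apply Rmult_le_compat_l; lra).
    assert (norm (a n) + norm (c n) <= g n) by (unfold g; lra); lra. }
  pose proof (Rmult_le_compat_l C1 _ _ HC1 H5); pose proof (g_parts n); lra.
Qed.

(** The descent inequality is perturbed at both ends, from [x n] to [x n - e] and from [t] to
    [x (S n)], with [g n] as the weight in [quad_perturb]. The constants are chosen before [z],
    which cases (a) and (d) require. *)
Lemma quasi_fejer : exists c1 c2, 0 <= c1 /\ 0 <= c2 /\ forall z, Z z -> forall n,
  V z (S n) <= (1 + c1 * g n) * V z n - eps / 2 * hinner (M n (hsub (x n) (r n))) (hsub (x n) (r n)) + c2 * g n.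
Proof.
  destruct (nnsum_bounded _ Hg) as [gb [Hgb Hgb']].
  set (C := / alpha * (1 + C1 * beta + C1) ^ 2).
  assert (HC : 0 <= C).
  { apply Rmult_le_pos; [apply Rlt_le, Rinv_0_lt_compat, Halpha | apply pow2_ge_0]. }
  assert (HCg : forall k s, 0 <= k -> k <= (1 + C1 * beta + C1) * s -> / alpha * k ^ 2 <= C * s ^ 2).
  { intros k s k0 Hk; unfold C; rewrite Rmult_assoc, <- Rpow_mult_distr.
    apply Rmult_le_compat_l; [apply Rlt_le, Rinv_0_lt_compat, Halpha | apply pow_incr; auto]. }
  clearbody C.
  assert (Pe : 0 < / eps) by (apply Rinv_0_lt_compat; lra).
  (* [c1] comes from [(1 + g) ^ 2 <= 1 + (2 + gb) g]. In [c2], each perturbation costs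
     [C (g + g ^ 2) <= C (1 + gb) g] and the descent error costs [(2 + / eps) C g ^ 2]; all but the
     last perturbation are multiplied by [1 + g <= 1 + gb]. *)
  exists (2 + gb), ((1 + gb) * (C * (1 + gb) + (2 + / eps) * C * gb) + C * (1 + gb)).
  split; [lra|]; split.
  { assert (0 <= C * (1 + gb)) by (apply Rmult_le_pos; lra).
    assert (0 <= (2 + / eps) * C * gb) by (repeat apply Rmult_le_pos; lra).
    apply Rplus_le_le_0_compat; auto; apply Rmult_le_pos; lra. }
  intros z Hz n.
  set (e := hscal (d n) (T n (a n))).
  set (t := hadd (r n) (hscal (d n) (T n (hsub (B (x n)) (B (r n)))))).
  set (R := hinner (M n (hsub (x n) (r n))) (hsub (x n) (r n))).
  pose proof (M_pos n (hsub (x n) (r n)) : 0 <= R) as PR.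
  pose proof (Hgb' n : g n <= gb) as Gb.
  pose proof (g_parts n) as [Ga [_ _]].
  assert (G0 : 0 <= g n) by lra.
  assert (Ne : norm e <= (1 + C1 * beta + C1) * g n).
  { eapply Rle_trans; [apply dT_norm|].
    assert (0 <= C1 * beta) by (apply Rmult_le_pos; lra).
    apply Rmult_le_compat; lra. }
  assert (Qe : hinner (M n e) e <= C * g n ^ 2).
  { eapply Rle_trans; [apply M_up_norm, Rle_refl|]; apply HCg; auto; apply norm_ge0. }
  assert (Qe' : hinner (M n (hopp e)) (hopp e) <= C * g n ^ 2).
  { eapply Rle_trans; [apply M_up_norm, Rle_refl|]; rewrite norm_opp; apply HCg; auto; apply norm_ge0. }
  assert (Qf : hinner (M n (hsub (x (S n)) t)) (hsub (x (S n)) t) <= C * g n ^ 2).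
  { eapply Rle_trans; [apply M_up_norm, Rle_refl|]; apply HCg; [apply norm_ge0 | apply error_norm]. }
  pose proof (Rinv_0_lt_compat mb Hmb) as Pmb.
  assert (S1 : V z (S n) <= (1 + g n) * hinner (M n (hsub t z)) (hsub t z) + C * (g n + g n ^ 2)).
  { eapply Rle_trans; [apply M_antitone|].
    replace (hsub (x (S n)) z) with (hadd (hsub t z) (hsub (x (S n)) t)) by vec.
    apply quad_perturb with (/ mb); auto using M_linear, M_sa, M_coercive. }
  assert (S2 : hinner (M n (hsub (hsub (x n) e) z)) (hsub (hsub (x n) e) z) <= (1 + g n) * V z n + C * (g n + g n ^ 2)).
  { replace (hsub (hsub (x n) e) z) with (hadd (hsub (x n) z) (hopp e)) by vec.
    apply quad_perturb with (/ mb); auto using M_linear, M_sa, M_coercive. }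
  assert (S3 : hinner (M n (hsub t z)) (hsub t z) <=
    hinner (M n (hsub (hsub (x n) e) z)) (hsub (hsub (x n) e) z) - eps / 2 * R + (2 + / eps) * hinner (M n e) e).
  { pose proof (d_pos n); apply (fbf_descent A B (T n) (M n) beta (m n)) with (u := u n);
      auto using M_linear, M_sa, M_pos; try lra.
    - intros v; apply M_low_of; auto.
    - apply A_max. }
  pose proof (M_pos n (hsub (x n) z) : 0 <= V z n) as PV.
  assert (S4 : hinner (M n (hsub t z)) (hsub t z) <= (1 + g n) * V z n + C * (g n + g n ^ 2) - eps / 2 * R + (2 + / eps) * (C * g n ^ 2)).
  { pose proof (Rmult_le_compat_l (2 + / eps) _ _ ltac:(lra) Qe); lra. }
  pose proof (Rmult_le_compat_l (1 + g n) _ _ ltac:(lra) S4) as S5.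
  assert (I1 : (1 + g n) * ((1 + g n) * V z n) <= (1 + (2 + gb) * g n) * V z n).
  { rewrite <- Rmult_assoc; apply Rmult_le_compat_r; auto; nra. }
  assert (I2 : eps / 2 * R <= (1 + g n) * (eps / 2 * R)).
  { assert (0 <= eps / 2 * R) by (apply Rmult_le_pos; lra); nra. }
  assert (I3 : C * (g n + g n ^ 2) <= C * (1 + gb) * g n).
  { rewrite Rmult_assoc; apply Rmult_le_compat_l; nra. }
  assert (I4 : (2 + / eps) * (C * g n ^ 2) <= (2 + / eps) * C * gb * g n).
  { rewrite !Rmult_assoc; repeat (apply Rmult_le_compat_l; [lra|]); nra. }
  assert (I5 : (1 + g n) * (C * (g n + g n ^ 2) + (2 + / eps) * (C * g n ^ 2)) <=
    (1 + gb) * (C * (1 + gb) * g n + (2 + / eps) * C * gb * g n)).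
  { apply Rmult_le_compat; try lra.
    apply Rplus_le_le_0_compat; repeat apply Rmult_le_pos; try lra; nra. }
  fold R; lra.
Qed.

Lemma residual_metric_summable_and_cv z : Z z ->
  nnsum (fun n => eps / 2 * hinner (M n (hsub (x n) (r n))) (hsub (x n) (r n))) /\ exists l, Un_cv (V z) l.
Proof.
  intros Hz; destruct quasi_fejer as [c1 [c2 [P1 [P2 H]]]].
  apply robbins_siegmund with (fun n => c1 * g n) (fun n => c2 * g n).
  - intros n; apply M_pos.
  - intros n; apply Rmult_le_pos; [lra | apply M_pos].
  - apply nnsum_scal; auto.
  - apply nnsum_scal; auto.
  - intros n; apply H, Hz.
Qed.

Lemma residual_summable : nnsum (fun n => norm (hsub (x n) (r n)) ^ 2).
Proof.
  destruct Hzer as [z Hz]; destruct (residual_metric_summable_and_cv z Hz) as [H _].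
  apply nnsum_le with (1 := nnsum_scal (2 / eps * mb) _ ltac:(apply Rlt_le, Rmult_lt_0_compat; [apply Rdiv_lt_0_compat|]; lra) H).
  intros n; split; [apply pow2_ge_0|]; rewrite norm_sq.
  eapply Rle_trans; [apply (M_low n)|]; apply Req_le; field; lra.
Qed.

Lemma residual_cv0 : Un_cv (fun n => norm (hsub (x n) (r n))) 0.
Proof. apply cv_sq0; [intros; apply norm_ge0 | apply nnsum_cv0, residual_summable]. Qed.

Lemma iterates_bounded : exists C, forall n, norm (x n) <= C.
Proof.
  destruct Hzer as [z Hz]; destruct (residual_metric_summable_and_cv z Hz) as [_ [l Hl]].
  destruct (maj_by_pos (V z)) as [D [HD HV]]; [exists l; exact Hl|].
  exists (norm z + (mb * D + 1)); intros n.
  eapply Rle_trans; [apply (norm_le_add_sub (x n) z)|]; apply Rplus_le_compat_l.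
  pose proof (HV n) as E; pose proof (Rle_abs (V z n)); pose proof (M_low n (hsub (x n) z)) as L.
  fold (V z n) in L; assert (mb * V z n <= mb * D) by (apply Rmult_le_compat_l; lra).
  assert (0 < mb * D) by (apply Rmult_lt_0_compat; auto).
  apply norm_le_sq; nra.
Qed.

(** Quantifies [step_residual]: the right side tends to 0, which will make [u n + B (r n)] vanish in
    the limit. *)
Lemma gap_norm n : norm (hscal (d n) (T n (hadd (u n) (B (r n))))) <= (1 + C1 * beta) * norm (hsub (x n) (r n)) + C1 * g n.
Proof.
  rewrite <- (step_residual B (T n) (d n) (x n) (a n) (r n) (u n)); auto.
  pose proof (g_parts n) as [Ga _].
  pose proof (dT_norm n (a n)) as H1; pose proof (dT_norm n (hsub (B (x n)) (B (r n)))) as H2.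
  pose proof (B_lip (x n) (r n)) as H3; pose proof (Rmult_le_compat_l C1 _ _ HC1 H3).
  assert (C1 * norm (a n) <= C1 * g n) by (apply Rmult_le_compat_l; lra).
  replace (hsub (hsub (x n) (hscal (d n) (T n (a n)))) (hadd (r n) (hscal (d n) (T n (hsub (B (x n)) (B (r n)))))))
    with (hsub (hsub (hsub (x n) (r n)) (hscal (d n) (T n (a n)))) (hscal (d n) (T n (hsub (B (x n)) (B (r n)))))) by vec.
  pose proof (norm_sub (hsub (hsub (x n) (r n)) (hscal (d n) (T n (a n)))) (hscal (d n) (T n (hsub (B (x n)) (B (r n)))))).
  pose proof (norm_sub (hsub (x n) (r n)) (hscal (d n) (T n (a n)))); lra.
Qed.

(** As [x (S n) = x n - y n + q n], this is the second series of (i). *)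
Lemma increment_summable : nnsum (fun n => norm (hsub (x n) (x (S n))) ^ 2).
Proof.
  set (k := 2 + C1 * beta + C1 * 2).
  assert (P0 : 0 <= C1 * beta) by (apply Rmult_le_pos; lra).
  apply nnsum_le with (fun n => 2 * k ^ 2 * norm (hsub (x n) (r n)) ^ 2 + 2 * k ^ 2 * g n ^ 2).
  { apply nnsum_add; apply nnsum_scal; try (pose proof (pow2_ge_0 k); lra).
    - apply residual_summable.
    - apply nnsum_sq, Hg. }
  intros n; split; [apply pow2_ge_0|].
  set (t := hadd (r n) (hscal (d n) (T n (hsub (B (x n)) (B (r n)))))).
  pose proof (error_norm n) as H1; fold t in H1.
  pose proof (dT_norm n (hsub (B (x n)) (B (r n)))) as H2.
  pose proof (B_lip (x n) (r n)) as H3; pose proof (Rmult_le_compat_l C1 _ _ HC1 H3).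
  pose proof (norm_sub_triangle t (x n) (x (S n))) as H4; rewrite (norm_sub_sym t) in H4.
  pose proof (norm_sub (hsub (x n) (r n)) (hscal (d n) (T n (hsub (B (x n)) (B (r n)))))) as H5.
  replace (hsub (hsub (x n) (r n)) (hscal (d n) (T n (hsub (B (x n)) (B (r n)))))) with (hsub (x n) t) in H5 by (unfold t; vec).
  pose proof (norm_ge0 (hsub (x n) (r n))) as N; pose proof (g_parts n).
  assert (H6 : norm (hsub (x n) (x (S n))) <= k * norm (hsub (x n) (r n)) + k * g n).
  { unfold k; nra. }
  pose proof (norm_ge0 (hsub (x n) (x (S n)))).
  apply Rle_trans with ((k * norm (hsub (x n) (r n)) + k * g n) ^ 2); [apply pow_incr; auto|].
  pose proof (pow2_ge_0 (k * norm (hsub (x n) (r n)) - k * g n)); lra.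
Qed.

(** * Weak convergence of the iterates *)

Lemma sum_value_cv0 : Un_cv (fun n => norm (hadd (u n) (B (r n)))) 0.
Proof.
  assert (P : 0 < dlo * alpha) by (apply Rmult_lt_0_compat; auto).
  pose proof (cv_add0 _ _ (cv_scal0 (1 + C1 * beta) _ residual_cv0) (cv_scal0 C1 _ (nnsum_cv0 _ Hg))) as H.
  eapply cv_le; [apply (cv_scal0 (/ (dlo * alpha)) _ H)|]; intros n; split; [apply norm_ge0|].
  set (w := hadd (u n) (B (r n))).
  apply Rmult_le_reg_l with (dlo * alpha); auto; rewrite <- Rmult_assoc, Rinv_r, Rmult_1_l by lra.
  eapply Rle_trans; [ | apply gap_norm]; fold w.
  pose proof (d_pos n); rewrite norm_scal, Rabs_pos_eq by lra.
  rewrite Rmult_assoc; apply Rmult_le_compat; auto; try lra.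
  { apply Rmult_le_pos; [lra | apply norm_ge0]. }
  (* Coercivity and Cauchy-Schwarz give [alpha |w| ^ 2 <= |T n w| |w|]. *)
  pose proof (T_low n w) as L; pose proof (inner_le_norm (T n w) w) as I; rewrite <- norm_sq in L.
  pose proof (norm_ge0 w); pose proof (norm_ge0 (T n w)).
  apply Rnot_lt_le; intro; nra.
Qed.

(* Cluster points [(w, b')] of [(x n, B (r n))] satisfy
   [<w, B h + v> + <b', h - y> <= <h, B h> + <y, v>] for all [h] and [(y, v)] in [gra A]; taking
   [h = w] gives [- b' \in A w], and then [y = w], [v = - b'] gives [b' = B w]. *)
Lemma weak_cluster_zer (P : nat -> Prop) : (forall n, exists k, (n <= k)%nat /\ P k) ->
  exists w, Z w /\ forall n, hull P x n w.
Proof.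
  intros HP; destruct iterates_bounded as [C HC].
  destruct (maj_by_pos (fun n => norm (hsub (x n) (r n)))) as [D [HD HD']].
  { exists 0; apply residual_cv0. }
  assert (HrC : forall n, norm (r n) <= C + D).
  { intros n; pose proof (norm_le_add_sub (r n) (x n)); rewrite (norm_sub_sym (r n)) in H.
    specialize (HC n); specialize (HD' n); pose proof (Rle_abs (norm (hsub (x n) (r n)))); lra. }
  set (C' := norm (B hzero) + beta * (C + D)).
  assert (HB : forall n, norm (B (r n)) <= C').
  { intros n; pose proof (norm_le_add_sub (B (r n)) (B hzero)); pose proof (B_lip (r n) hzero).
    replace (hsub (r n) hzero) with (r n) in * by vec.
    pose proof (Rmult_le_compat_l beta _ _ ltac:(lra) (HrC n)); unfold C'; lra. }
  destruct (weak_cluster (K := prodH K K) P (fun n => (x n, B (r n))) (C + C') HP) as [[w b'] Hw].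
  { intros n; unfold norm; simpl; eapply Rle_trans; [apply sqrt_add_le; apply hinner_pos|].
    apply Rplus_le_compat; [apply HC | apply HB]. }
  exists w; split.
  2: { intros n z rho Hk; pose proof (Hw n (z, hzero) rho) as H; simpl in H.
       rewrite inner_zero_r, Rplus_0_r in H; apply H.
       intros k Lk Pk; simpl; rewrite inner_zero_r, Rplus_0_r; auto. }
  (* When the monotonicity inequalities of [A] and [B] are added, the product [<r k, B (r k)>] is
     absorbed by [<r k - y, u k + B (r k)>], which tends to 0. The rest is affine in
     [(r k, B (r k))], and [r k] may be replaced by [x k]. *)
  assert (I : forall h y v, A y v ->
    hinner w (hadd (B h) v) + hinner b' (hsub h y) <= hinner h (B h) + hinner y v).
  { intros h y v Av; apply le_epsilon; intros e He.
    assert (L : Un_cv (fun n => (C + D + norm y) * norm (hadd (u n) (B (r n))) + norm (hadd (B h) v) * norm (hsub (x n) (r n))) 0).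
    { apply cv_add0; apply cv_scal0; [apply sum_value_cv0 | apply residual_cv0]. }
    destruct (L e He) as [N HN].
    pose proof (Hw N (hadd (B h) v, hsub h y) (hinner h (B h) + hinner y v + e)) as H; simpl in H.
    apply H; intros k Lk _; simpl; specialize (HN k Lk); unfold Rdist in HN; rewrite Rminus_0_r in HN.
    apply Rabs_def2 in HN.
    pose proof (proj1 A_max (r k) y (u k) v (Hu k) Av) as H1.
    pose proof (B_mon (r k) h (B (r k)) (B h) eq_refl eq_refl) as H2.
    assert (H3 : hinner (hsub (r k) y) (hadd (u k) (B (r k))) <= (C + D + norm y) * norm (hadd (u k) (B (r k)))).
    { eapply Rle_trans; [apply inner_le_norm|]; apply Rmult_le_compat_r; [apply norm_ge0|].
      pose proof (norm_sub (r k) y); specialize (HrC k); lra. }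
    assert (H4 : hinner (hsub (x k) (r k)) (hadd (B h) v) <= norm (hadd (B h) v) * norm (hsub (x k) (r k))).
    { rewrite Rmult_comm; apply inner_le_norm. }
    assert (HN1 := proj1 HN); clear HN.
    rewrite !inner_sub_l, !inner_sub_r in H1, H2; rewrite inner_sub_l, inner_add_r in H3; rewrite inner_sub_l, !inner_add_r in H4.
    rewrite inner_add_r, inner_sub_r, (hinner_sym (B (r k)) h), (hinner_sym (B (r k)) y).
    rewrite inner_add_r in H3; lra. }
  assert (Aw : A w (hopp b')).
  { apply (proj2 A_max); intros y v Av; specialize (I w y v Av); revert I.
    inner_expand_all; rewrite (hinner_sym b' w), (hinner_sym b' y); lra. }
  assert (Eb : hsub b' (B w) = hzero).
  (* Minty's trick with a finite step: moving from [w] along [k] by [/ (2 * beta)] changes [B] by at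
     most half the norm of [k], so [<k, k> <= <k, k> / 2]. *)
  { set (k := hsub b' (B w)); set (h := hadd w (hscal (/ (2 * beta)) k)).
    assert (Pb : 0 < / (2 * beta)) by (apply Rinv_0_lt_compat; lra).
    pose proof (I h w (hopp b') Aw) as J.
    assert (J' : hinner k (hsub b' (B h)) <= 0).
    { apply Rmult_le_reg_l with (/ (2 * beta)); auto; rewrite Rmult_0_r, <- hinner_scal_l.
      replace (hscal (/ (2 * beta)) k) with (hsub h w) by (unfold h; vec).
      revert J; inner_expand_all; rewrite (hinner_sym b' h), (hinner_sym b' w); lra. }
    assert (Q : hinner k (hsub (B h) (B w)) <= / 2 * hinner k k).
    { eapply Rle_trans; [apply inner_le_norm|].
      pose proof (B_lip h w) as Q; replace (hsub h w) with (hscal (/ (2 * beta)) k) in Q by (unfold h; vec).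
      rewrite norm_scal, Rabs_pos_eq, <- Rmult_assoc in Q by lra.
      replace (beta * / (2 * beta)) with (/ 2) in Q by (field; lra).
      rewrite <- norm_sq; pose proof (norm_ge0 k); nra. }
    apply inner_self_le0.
    assert (E : hinner k k = hinner k (hsub b' (B h)) + hinner k (hsub (B h) (B w))).
    { unfold k at 2; inner_expand_all; ring. }
    lra. }
  exists (hopp b'); split; auto.
  replace (B w) with b' by (apply inner_ext; intros z; pose proof (f_equal (fun v => hinner v z) Eb) as E;
    simpl in E; rewrite inner_sub_l, inner_zero_l in E; lra); vec.
Qed.

Lemma metric_strong_cv v : exists g', strong_cv (fun n => M n v) g'.
Proof.
  apply monotone_operators_cv with (/ alpha).
  - apply M_linear.
  - apply M_sa.
  - apply Rinv_0_lt_compat, Halpha.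
  - intros n h; rewrite Rabs_pos_eq by apply M_pos; apply M_up.
  - apply M_antitone.
Qed.

(** The negatives of [T n] decrease. Case (d) uses this limit to return from [M n (x n - z0)] to the
    iterates. *)
Lemma T_strong_cv v : exists g', strong_cv (fun n => T n v) g'.
Proof.
  destruct (monotone_operators_cv (fun n h => hopp (T n h)) mb v) as [g' Hg'].
  - intros n; split; intros.
    + rewrite (proj1 (LT n)); vec.
    + rewrite (proj2 (LT n)); vec.
  - intros n v1 v2; inner_expand; rewrite (ST n); reflexivity.
  - auto.
  - intros n h; rewrite inner_opp_l, Rabs_Ropp, Rabs_pos_eq by apply T_pos; apply T_le_mb.
  - intros n h; rewrite !inner_opp_l; specialize (T_mono n h); lra.
  - exists (hopp g'); eapply cv_ext; [ | exact Hg']; intros n; simpl.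
    rewrite <- norm_opp; f_equal; vec.
Qed.

(* Opial's argument: [V w n - V w' n] determines the limit of [<x n, M n (w' - w)>]. *)
Lemma weak_cluster_unique P P' w w' : Z w -> Z w' ->
  (forall n, hull P x n w) -> (forall n, hull P' x n w') -> w = w'.
Proof.
  intros Zw Zw' Hw Hw'.
  destruct (residual_metric_summable_and_cv w Zw) as [_ [l Hl]].
  destruct (residual_metric_summable_and_cv w' Zw') as [_ [l' Hl']].
  destruct (metric_strong_cv w) as [gw Gw]; destruct (metric_strong_cv w') as [gw' Gw'].
  set (v := hsub w' w); destruct (metric_strong_cv v) as [gv Gv].
  destruct iterates_bounded as [C HC].
  assert (E : Un_cv (fun n => hinner (x n) (M n v)) (/ 2 * (l - l' - hinner gw w + hinner gw' w'))).
  { apply cv_ext with (fun n => / 2 * (V w n - V w' n - hinner (M n w) w + hinner (M n w') w')).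
    - intros n; unfold V, v; rewrite !quad_sub by auto using M_linear, M_sa.
      rewrite !(fun v w => linear_sub (M n) v w (M_linear n)), inner_sub_r.
      rewrite !(M_sa n (x n)); field.
    - apply CV_mult; [intros e He; exists O; intros; unfold Rdist; rewrite Rminus_diag, Rabs_R0; auto|].
      apply CV_plus; [apply CV_minus; [apply CV_minus|]|]; auto.
      + apply (strong_cv_weak _ _ Gw).
      + apply (strong_cv_weak _ _ Gw'). }
  pose proof (inner_cv_bounded_strong x _ gv C _ HC Gv E) as F.
  pose proof (hull_limit P x w gv _ Hw F) as H1; pose proof (hull_limit P' x w' gv _ Hw' F) as H2.
  assert (H3 : hinner gv v = 0) by (unfold v; rewrite inner_sub_r, !(hinner_sym gv); lra).
  (* [gv] is the limit of [M n v], so [<gv, v>] inherits the coercivity constant [/ mb], in conflict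
     with [H3] unless [v = 0]. *)
  assert (H4 : v = hzero).
  { apply inner_self_le0; apply Rnot_lt_le; intros Pv.
    pose proof (Rinv_0_lt_compat mb Hmb) as Pm.
    destruct (strong_cv_weak _ _ Gv v (/ mb * hinner v v)) as [N HN]; [apply Rmult_lt_0_compat; auto|].
    specialize (HN N (le_n N)); rewrite H3 in HN; unfold Rdist in HN; rewrite Rminus_0_r in HN.
    apply Rabs_def2 in HN; pose proof (M_coercive N v); lra. }
  replace w' with (hadd w v) by (unfold v; vec); rewrite H4; vec.
Qed.

(** If the upper bound in a direction [z] fails infinitely often, the failing indices have a cluster
    point of their own. It is a zero, hence equal to [w] by uniqueness, yet a half-space separates
    it from [w]. The lower bound is the case of the opposite direction. *)
Lemma iterates_weak_cv : exists w, Z w /\ weak_cv x w.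
Proof.
  destruct (weak_cluster_zer (fun _ => True)) as [w [Zw Hw]]; [intros n; exists n; auto|].
  exists w; split; auto.
  assert (H : forall z e, 0 < e -> exists N, forall n, (N <= n)%nat -> hinner (x n) z < hinner w z + e).
  { intros z e He; apply NNPP; intros Hn.
    destruct (weak_cluster_zer (fun n => hinner w z + e <= hinner (x n) z)) as [w' [Zw' Hw']].
    { intros N; apply NNPP; intros Hk; apply Hn; exists N; intros n Ln.
      apply Rnot_le_lt; intros L; apply Hk; exists n; auto. }
    pose proof (weak_cluster_unique _ _ w w' Zw Zw' Hw Hw') as Ew; subst w'.
    pose proof (Hw' O (hopp z) (- (hinner w z + e))) as L; rewrite inner_opp_r in L.
    enough (- hinner w z <= - (hinner w z + e)) by lra.
    apply L; intros k _ Hk; simpl in Hk; rewrite inner_opp_r; lra. }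
  intros z e He; destruct (H z e He) as [N1 H1]; destruct (H (hopp z) e He) as [N2 H2].
  exists (max N1 N2); intros n Ln.
  specialize (H1 n ltac:(lia)); specialize (H2 n ltac:(lia)); rewrite !inner_opp_r in H2.
  unfold Rdist; apply Rabs_def1; lra.
Qed.

(** * Strong convergence under conditions (a) to (c) *)

Lemma iterates_strong_of_resolvents w : strong_cv r w -> strong_cv x w.
Proof. intros H; apply strong_cv_near with (1 := H); apply residual_cv0. Qed.

Lemma resolvents_weak w : weak_cv x w -> weak_cv r w.
Proof.
  intros H; apply weak_cv_near with (1 := H).
  eapply cv_ext; [ | apply residual_cv0]; intros n; apply norm_sub_sym.
Qed.

Lemma strong_of_demiregular w : Z w -> weak_cv x w -> demiregular_at (op_sum A B) w -> strong_cv x w.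
Proof.
  intros Zw Hw H; apply iterates_strong_of_resolvents.
  apply (H r (fun n => hadd (u n) (B (r n))) hzero).
  - intros n; exists (u n); auto.
  - exact Zw.
  - apply resolvents_weak, Hw.
  - eapply cv_ext; [ | apply sum_value_cv0]; intros n; simpl; f_equal; vec.
Qed.

(** Common to both halves of (c), since monotonicity of the other operator only enlarges the right
    side. That right side tends to 0, while [phi] stays away from 0 at distances at least [e]. *)
Lemma modulus_strong_cv w (phi : R -> Rbar) : weak_cv x w ->
  (forall t, 0 <= t -> Rbar_le (Fin 0) (phi t)) ->
  (forall s t, 0 <= s -> s <= t -> Rbar_le (phi s) (phi t)) ->
  (forall t, 0 < t -> phi t <> Fin 0) ->
  (forall n, Rbar_le (phi (norm (hsub w (r n)))) (Fin (hinner (hsub (r n) w) (hadd (u n) (B (r n)))))) ->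
  strong_cv x w.
Proof.
  intros Hw P0 Pm Pz H; apply iterates_strong_of_resolvents.
  destruct iterates_bounded as [C HC].
  destruct (maj_by_pos (fun n => norm (hsub (x n) (r n)))) as [D [HD HD']].
  { exists 0; apply residual_cv0. }
  assert (HrC : forall n, norm (hsub (r n) w) <= C + D + norm w).
  { intros n; pose proof (norm_le_add_sub (r n) (x n)) as L; rewrite (norm_sub_sym (r n)) in L.
    specialize (HC n); specialize (HD' n); pose proof (Rle_abs (norm (hsub (x n) (r n)))).
    pose proof (norm_sub (r n) w); lra. }
  intros e He.
  (* A finite value [phi e] is itself the threshold; for an infinite one any positive number will
     do. *)
  assert (Ht : exists t, 0 < t /\ forall s, phi e = Fin s -> t <= s).
  { pose proof (P0 e (Rlt_le _ _ He)) as Q; pose proof (Pz e He) as Q'.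
    destruct (phi e) as [s|]; [ | exists 1; split; [lra | intros; discriminate]].
    exists s; simpl in Q; split; [destruct Q as [Q|Q]; auto; exfalso; apply Q'; f_equal; auto|].
    intros s' E; injection E; intros; lra. }
  destruct Ht as [t [Ht Hs]].
  destruct (cv_scal0 (C + D + norm w) _ sum_value_cv0 t Ht) as [N HN].
  exists N; intros n Ln; specialize (HN n Ln); unfold Rdist in *; rewrite Rminus_0_r in *.
  apply Rabs_def2 in HN; destruct HN as [HN _].
  rewrite Rabs_pos_eq by apply norm_ge0; rewrite norm_sub_sym.
  apply Rnot_le_lt; intros L.
  pose proof (Pm e _ (Rlt_le _ _ He) L) as Q; pose proof (H n) as Q'.
  assert (Q'' : hinner (hsub (r n) w) (hadd (u n) (B (r n))) < t).
  { apply Rle_lt_trans with (2 := HN); eapply Rle_trans; [apply inner_le_norm|].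
    apply Rmult_le_compat_r; auto; apply norm_ge0. }
  destruct (phi (norm (hsub w (r n)))) as [s'|]; simpl in Q'; [ | contradiction].
  destruct (phi e) as [s|]; simpl in Q; [ | contradiction].
  specialize (Hs s eq_refl); lra.
Qed.

Lemma strong_of_uniform_A w : Z w -> weak_cv x w -> uniformly_monotone_at A w -> strong_cv x w.
Proof.
  intros [v [Av Ev]] Hw [_ [phi [P0 [Pm [_ [Pz H]]]]]].
  apply modulus_strong_cv with phi; auto.
  intros n; specialize (H v (r n) (u n) Av (Hu n)).
  destruct (phi (norm (hsub w (r n)))) as [s|]; simpl in *; auto.
  pose proof (B_mon (r n) w (B (r n)) (B w) eq_refl eq_refl) as Q.
  assert (E : hinner (hsub (r n) w) (hadd v (B w)) = 0) by (rewrite <- Ev; apply inner_zero_r).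
  revert H Q E; inner_expand_all; lra.
Qed.

Lemma strong_of_uniform_B w : Z w -> weak_cv x w -> uniformly_monotone_at (graph B) w -> strong_cv x w.
Proof.
  intros [v [Av Ev]] Hw [_ [phi [P0 [Pm [_ [Pz H]]]]]].
  apply modulus_strong_cv with phi; auto.
  intros n; specialize (H (B w) (r n) (B (r n)) eq_refl eq_refl).
  destruct (phi (norm (hsub w (r n)))) as [s|]; simpl in *; auto.
  pose proof (proj1 A_max (r n) w (u n) v (Hu n) Av) as Q.
  assert (E : hinner (hsub (r n) w) (hadd v (B w)) = 0) by (rewrite <- Ev; apply inner_zero_r).
  revert H Q E; inner_expand_all; lra.
Qed.

Lemma quasi_fejer_bound : exists E f, 0 <= E /\ nnsum f /\ forall z, Z z -> forall n k, (n <= k)%nat ->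
  V z k <= E * (V z n + (psum f k - psum f n)).
Proof.
  destruct quasi_fejer as [c1 [c2 [P1 [P2 H]]]].
  assert (N1 : nnsum (fun n => c1 * g n)) by (apply nnsum_scal; auto).
  assert (N2 : nnsum (fun n => c2 * g n)) by (apply nnsum_scal; auto).
  destruct (pprod_bounded _ N1) as [E [E1 HE]].
  exists E, (fun n => c2 * g n); split; [lra|]; split; auto; intros z Hz n k L.
  apply quasi_decreasing_bound with
    (Q := fun n => eps / 2 * hinner (M n (hsub (x n) (r n))) (hsub (x n) (r n))) (g := fun n => c1 * g n); auto.
  - intros i; apply M_pos.
  - intros i; apply Rmult_le_pos; [lra | apply M_pos].
Qed.

(** A zero close to a late iterate remains close to all later ones by [quasi_fejer_bound], so the
    sequence is Cauchy; its strong limit must be [w]. *)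
Lemma strong_of_dist w : weak_cv x w ->
  (forall e N, 0 < e -> exists n z, (N <= n)%nat /\ Z z /\ norm (hsub (x n) z) < e) -> strong_cv x w.
Proof.
  intros Hw H; destruct quasi_fejer_bound as [E [f [E0 [Nf HE]]]].
  destruct (cauchy_strong_cv x) as [l Hl].
  { intros e He.
    (* At index [N], [V z N] is at most [h ^ 2 / alpha] and the error tail is below [h ^ 2], so
       later squared distances to [z] are at most [(k - 1) h ^ 2 <= (k h) ^ 2], with
       [k h = e / 4]. *)
    set (k := mb * E * (/ alpha + 1) + 1).
    assert (Pa : 0 < / alpha) by (apply Rinv_0_lt_compat, Halpha).
    assert (Pk : 1 <= k).
    { unfold k; enough (0 <= mb * E * (/ alpha + 1)) by lra; repeat apply Rmult_le_pos; lra. }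
    set (h := e / (4 * k)).
    assert (Ph : 0 < h) by (apply Rdiv_lt_0_compat; lra).
    destruct (nnsum_tail f (h ^ 2) Nf ltac:(nra)) as [N0 HN0].
    destruct (H h N0 Ph) as [N [z [LN [Hz Hd']]]].
    assert (B' : forall n, (N <= n)%nat -> norm (hsub (x n) z) <= k * h).
    { intros n Ln; apply norm_le_sq; [apply Rmult_le_pos; lra|].
      eapply Rle_trans; [apply (M_low n)|]; fold (V z n).
      pose proof (HE z Hz N n Ln) as H1; pose proof (HN0 N n LN Ln) as H2.
      pose proof (M_up_norm N _ h (Rlt_le _ _ Hd')) as H3; fold (V z N) in H3.
      apply Rle_trans with (mb * (E * ((/ alpha + 1) * h ^ 2))).
      - apply Rmult_le_compat_l; [lra|]; eapply Rle_trans; [apply H1|].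
        apply Rmult_le_compat_l; lra.
      - replace (mb * (E * ((/ alpha + 1) * h ^ 2))) with ((k - 1) * h ^ 2) by (unfold k; ring).
        rewrite Rpow_mult_distr; apply Rmult_le_compat_r; [apply pow2_ge_0 | nra]. }
    exists N; intros n m' Ln Lm.
    eapply Rle_lt_trans; [apply (norm_sub_triangle z)|]; rewrite (norm_sub_sym z).
    pose proof (B' n Ln) as B1; pose proof (B' m' ltac:(lia)) as B2.
    assert (Ek : k * h = e / 4) by (unfold h; field; lra); lra. }
  rewrite (weak_cv_unique x w l Hw (strong_cv_weak _ _ Hl)); exact Hl.
Qed.

(** * Strong convergence when the set of zeros has interior points *)

Section Interior.
Variable nu : nat -> R.
Hypothesis Hnu : nnsum nu.
Hypothesis T_nu : forall n v, hinner (T (S n) v) v <= (1 + nu n) * hinner (T n v) v.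
Variables (z0 : K) (rho : R).
Hypothesis Hrho : 0 < rho.
Hypothesis Hball : forall z, norm (hsub z z0) < rho -> Z z.

Lemma M_nu n v : hinner (M n v) v <= (1 + nu n) * hinner (M (S n) v) v.
Proof.
  pose proof (proj1 Hnu n); revert v.
  apply inverse_order with (T n) (T (S n)); auto; [intros; apply T_pos | lra].
Qed.

(** A bound on [V z n] uniform over the ball makes the perturbation additive and independent of [z],
    so that [z] may later change with [n]. *)
Lemma uniform_fejer_on_ball : exists f, nnsum f /\ forall z, norm (hsub z z0) < rho ->
  forall n, V z (S n) <= V z n + f n.
Proof.
  destruct quasi_fejer_bound as [E [f [E0 [Nf HE]]]].
  destruct quasi_fejer as [c1 [c2 [P1 [P2 H]]]].
  pose proof Nf as [_ [Cf HCf]].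
  set (D := E * (/ alpha * (norm (hsub (x O) z0) + rho) ^ 2 + Cf)).
  assert (HD : forall z, norm (hsub z z0) < rho -> forall n, V z n <= D).
  { intros z Hz n; eapply Rle_trans; [apply (HE z (Hball z Hz) O n); lia|].
    apply Rmult_le_compat_l; auto; simpl psum; rewrite Rminus_0_r; apply Rplus_le_compat; auto.
    apply M_up_norm; pose proof (norm_sub_triangle z0 (x O) z); rewrite (norm_sub_sym z0) in *; lra. }
  assert (D0 : 0 <= D).
  { eapply Rle_trans; [apply (M_pos O) | apply (HD z0)].
    replace (hsub z0 z0) with (@hzero K) by vec; rewrite norm_zero; auto. }
  exists (fun n => (c1 * D + c2) * g n); split.
  { apply nnsum_scal; auto; apply Rplus_le_le_0_compat; auto; apply Rmult_le_pos; auto. }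
  intros z Hz n; pose proof (H z (Hball z Hz) n); specialize (HD z Hz n).
  pose proof (M_pos n (hsub (x n) (r n))) as Pr.
  assert (0 <= eps / 2 * hinner (M n (hsub (x n) (r n))) (hsub (x n) (r n))) by (apply Rmult_le_pos; lra).
  pose proof (g_parts n).
  assert (c1 * g n * V z n <= c1 * g n * D) by (apply Rmult_le_compat_l; auto; apply Rmult_le_pos; lra).
  lra.
Qed.

(* The Fejer inequality at [z0 - s], with [s] parallel to [xi (S n) - xi n], bounds that increment
   by a telescoping plus a summable term. *)
Lemma metric_images_strong_cv : exists xi, strong_cv (fun n => M n (hsub (x n) z0)) xi.
Proof.
  destruct uniform_fejer_on_ball as [f [Nf Hf]].
  set (xi := fun n => M n (hsub (x n) z0)).
  (* The first term is the price of changing the metric at [s]: the forms of [M n] and [M (S n)]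
     differ there by at most [nu n] times [rho ^ 2 / alpha]. *)
  set (G := fun n => nu n * (/ alpha * rho ^ 2) + f n).
  assert (Pa : 0 < / alpha) by (apply Rinv_0_lt_compat, Halpha).
  assert (NG : nnsum G).
  { apply nnsum_add; auto; apply nnsum_le with (fun n => (/ alpha * rho ^ 2) * nu n).
    - apply nnsum_scal; auto; apply Rmult_le_pos; [lra | apply pow2_ge_0].
    - intros n; pose proof (proj1 Hnu n); split; [ | lra].
      apply Rmult_le_pos; auto; apply Rmult_le_pos; [lra | apply pow2_ge_0]. }
  assert (I : forall n s, norm s < rho -> 2 * hinner (hsub (xi (S n)) (xi n)) s <= V z0 n - V z0 (S n) + G n).
  { intros n s Hs.
    assert (Hz : norm (hsub (hsub z0 s) z0) < rho).
    { replace (hsub (hsub z0 s) z0) with (hopp s) by vec; rewrite norm_opp; auto. }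
    pose proof (Hf _ Hz n) as J; unfold V in J.
    replace (hsub (x (S n)) (hsub z0 s)) with (hadd (hsub (x (S n)) z0) s) in J by vec.
    replace (hsub (x n) (hsub z0 s)) with (hadd (hsub (x n) z0) s) in J by vec.
    rewrite !quad_add in J by auto using M_linear, M_sa.
    pose proof (M_nu n s) as J2; pose proof (M_up_norm (S n) s rho (Rlt_le _ _ Hs)) as J3.
    pose proof (Rmult_le_compat_l (nu n) _ _ (proj1 Hnu n) J3).
    unfold xi, V, G; rewrite inner_sub_l; lra. }
  assert (W : forall n, rho * norm (hsub (xi (S n)) (xi n)) <= V z0 n - V z0 (S n) + G n).
  { intros n; set (D := hsub (xi (S n)) (xi n)); pose proof (norm_ge0 D) as PD.
    destruct (Req_dec (norm D) 0) as [Z0|Z0].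
    - rewrite Z0, Rmult_0_r; specialize (I n hzero); rewrite norm_zero, inner_zero_r in I.
      specialize (I Hrho); lra.
    (* This [s] has norm [rho / 2], safely inside the open ball, and [2 <D, s> = rho |D|]. *)
    - pose proof (I n (hscal (rho / (2 * norm D)) D)) as J; fold D in J.
      rewrite norm_scal, Rabs_pos_eq, inner_scal_r, <- norm_sq in J
        by (apply Rlt_le, Rdiv_lt_0_compat; lra).
      replace (rho / (2 * norm D) * norm D) with (rho / 2) in J by (field; auto).
      replace (2 * (rho / (2 * norm D) * norm D ^ 2)) with (rho * norm D) in J by (field; auto).
      apply J; lra. }
  apply summable_increments_strong_cv with (fun n => / rho * (V z0 n - V z0 (S n) + G n)).
  - apply nnsum_scal; [apply Rlt_le, Rinv_0_lt_compat, Hrho|]; split.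
    + intros n; eapply Rle_trans; [ | apply W]; apply Rmult_le_pos; [lra | apply norm_ge0].
    + pose proof NG as [_ [C HC]]; exists (V z0 O + C); intros n.
      assert (Te : psum (fun n => V z0 n - V z0 (S n) + G n) n = V z0 O - V z0 n + psum G n).
      { induction n as [|n IH]; simpl psum; [ring | rewrite IH; ring]. }
      rewrite Te; specialize (HC n); pose proof (M_pos n (hsub (x n) z0) : 0 <= V z0 n); lra.
  - intros n; apply Rmult_le_reg_l with rho; auto.
    rewrite <- Rmult_assoc, Rinv_r, Rmult_1_l by lra; apply W.
Qed.

(** Applying the uniformly bounded [T n] to [M n (x n - z0) - xi] shows that [x n - z0 - T n xi]
    tends to 0, and [T n xi] converges. *)
Lemma strong_of_interior w : weak_cv x w -> strong_cv x w.
Proof.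
  intros Hw; destruct metric_images_strong_cv as [xi Hxi]; destruct (T_strong_cv xi) as [t Ht].
  assert (Hl : strong_cv x (hadd z0 t)).
  { apply strong_cv_near with (fun n => hadd z0 (T n xi)).
    - eapply cv_ext; [ | exact Ht]; intros n; simpl; f_equal; vec.
    - eapply cv_le; [apply (cv_scal0 mb _ Hxi)|]; intros n; split; [apply norm_ge0|].
      eapply Rle_trans; [ | apply (T_up n)]; apply Req_le; f_equal.
      rewrite linear_sub, TM by auto; vec. }
  rewrite (weak_cv_unique x w _ Hw (strong_cv_weak _ _ Hl)); exact Hl.
Qed.

End Interior.

Lemma fbf_convergence : exists w, Z w /\ weak_cv x w /\
  ((exists dist : nat -> R, (forall n, dist_is Z (x n) (dist n)) /\ liminf_is dist 0) \/
   demiregular_at (op_sum A B) w \/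
   (uniformly_monotone_at A w \/ uniformly_monotone_at (graph B) w) \/
   (interior_nonempty Z /\ exists nu, nnsum nu /\
      forall n v, hinner (T (S n) v) v <= (1 + nu n) * hinner (T n v) v) -> strong_cv x w).
Proof.
  destruct iterates_weak_cv as [w [Zw Hw]]; exists w; split; [exact Zw|]; split; [exact Hw|].
  intros [[dist [H1 H2]]|[H|[[H|H]|[[z0 [rho [Hrho Hball]]] [nu [Nnu Hnu]]]]]].
  - apply strong_of_dist; auto; apply liminf_dist_zero with dist; auto.
  - apply strong_of_demiregular; auto.
  - apply strong_of_uniform_A; auto.
  - apply strong_of_uniform_B; auto.
  - apply strong_of_interior with nu z0 rho; auto.
Qed.

End Iterates.

(** * From the given operators to the rescaled ones *)

(** The supremum ranges over operator norms given as a relation, so each norm must first be shown to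
    exist. *)
Lemma operator_norm_bound (K : Hilbert) (U : nat -> K -> K) (mu : R) :
  (forall n, is_bounded_linear (U n)) -> is_lub (fun r => exists n, opnorm_is (U n) r) mu ->
  0 <= mu /\ forall n v, norm (U n v) <= mu * norm v.
Proof.
  intros HU [Hmu _].
  assert (Ex : forall n, exists r, opnorm_is (U n) r).
  { intros n; destruct (HU n) as [Ha [Hs [c Hc]]].
    destruct (completeness (fun s => exists x, norm x <= 1 /\ s = norm (U n x))) as [r Hr]; [ | | exists r; exact Hr].
    - exists (Rabs c); intros s [x [Hx ->]]; eapply Rle_trans; [apply Hc|].
      pose proof (Rle_abs c); pose proof (norm_ge0 x); pose proof (Rabs_pos c); nra.
    - exists (norm (U n hzero)), hzero; rewrite norm_zero; split; [lra|reflexivity]. }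
  assert (Le : forall n v, norm v <= 1 -> norm (U n v) <= mu).
  { intros n v Hv; destruct (Ex n) as [r Hr]; apply Rle_trans with r.
    - apply Hr; exists v; auto.
    - apply Hmu; exists n; exact Hr. }
  split.
  - eapply Rle_trans; [apply (norm_ge0 (U O hzero)) | apply (Le O hzero)]; rewrite norm_zero; lra.
  - intros n v; destruct (HU n) as [_ [Hs [c Hc]]]; destruct (Req_dec (norm v) 0) as [Z|Z].
    + specialize (Hc v); rewrite Z, Rmult_0_r in *; exact Hc.
    + pose proof (norm_ge0 v) as P; assert (Pi : 0 < / norm v) by (apply Rinv_0_lt_compat; lra).
      pose proof (Le n (hscal (/ norm v) v)) as L.
      rewrite Hs, !norm_scal, Rabs_pos_eq, Rinv_l in L by lra.
      apply Rmult_le_reg_l with (/ norm v); auto.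
      rewrite (Rmult_comm mu), <- Rmult_assoc, Rinv_l by lra; rewrite Rmult_1_l; apply L; lra.
Qed.

Theorem theorem3p1
  (K : Hilbert) (alpha beta : R) (eta : nat -> R) (U : nat -> K -> K) (mu : R)
  (A : setop K) (B : K -> K) (a b c : nat -> K) (x0 : K) (eps : R)
  (gamma : nat -> R) (x y p q : nat -> K)
  (Halpha : 0 < alpha) (Hbeta : 0 < beta)
  (Heta_nonneg : forall n, 0 <= eta n) (Heta_sum : summable eta)
  (HU_bl : forall n, is_bounded_linear (U n))
  (Hmu : is_lub (fun r => exists n, opnorm_is (U n) r) mu)
  (HU_mon : forall n, loewner_ge (op_scal (1 + eta n) (U (S n))) (U n))
  (HU_P : forall n, in_P alpha (U n))
  (HA : maximally_monotone A)
  (HBmon : single_monotone B) (HBlip : lipschitz beta B)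
  (Hzer : exists z, zer (op_sum A B) z)
  (Ha : summable (fun n => norm (a n)))
  (Hb : summable (fun n => norm (b n)))
  (Hc : summable (fun n => norm (c n)))
  (Heps : 0 < eps < 1 / (beta * mu + 1))
  (Hgamma : forall n, eps <= gamma n <= (1 - eps) / (beta * mu))
  (Hx0 : x 0%nat = x0)
  (Hy : forall n, y n = hsub (x n) (hscal (gamma n) (U n (hadd (B (x n)) (a n)))))
  (Hp : forall n, resolvent (op_scaled (gamma n) (U n) A) (y n) (hsub (p n) (b n)))
  (Hq : forall n, q n = hsub (p n) (hscal (gamma n) (U n (hadd (B (p n)) (c n)))))
  (Hx : forall n, x (S n) = hadd (hsub (x n) (y n)) (q n)) :
  exists xbar, zer (op_sum A B) xbar /\
    (summable (fun n => norm (hsub (x n) (p n)) ^ 2) /\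
     summable (fun n => norm (hsub (y n) (q n)) ^ 2)) /\
    (weak_cv x xbar /\ weak_cv p xbar) /\
    ((  (exists d : nat -> R, (forall n, dist_is (zer (op_sum A B)) (x n) (d n)) /\ liminf_is d 0)
     \/ demiregular_at (op_sum A B) xbar
     \/ (uniformly_monotone_at A xbar \/ uniformly_monotone_at (graph B) xbar)
     \/ (interior_nonempty (zer (op_sum A B)) /\
         exists nu : nat -> R, (forall n, 0 <= nu n) /\ summable nu /\
           forall n, loewner_ge (op_scal (1 + nu n) (U n)) (U (S n))))
     -> strong_cv x xbar /\ strong_cv p xbar).
Proof.
  destruct (operator_norm_bound K U mu HU_bl Hmu) as [mu0 HUn].
  assert (mu_pos : 0 < mu).
  (* If [mu = 0], the upper bound on [gamma O] is a quotient by 0, equal to 0 by the convention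
     [/ 0 = 0], against [eps <= gamma O]. *)
  { destruct mu0 as [h|<-]; auto; exfalso; specialize (Hgamma O).
    rewrite Rmult_0_r in Hgamma; unfold Rdiv in Hgamma; rewrite Rinv_0, Rmult_0_r in Hgamma; lra. }
  assert (bm_pos : 0 < beta * mu) by (apply Rmult_lt_0_compat; auto).
  assert (eps1 : 0 < eps < 1).
  { split; [lra|]; apply Rlt_le_trans with (1 := proj2 Heps).
    apply Rmult_le_reg_r with (beta * mu + 1); [lra|]; unfold Rdiv; rewrite Rmult_assoc, Rinv_l; lra. }
  assert (Hgbm : forall n, gamma n * (beta * mu) <= 1 - eps).
  { intros n; destruct (Hgamma n) as [_ h]; apply (Rmult_le_compat_r (beta * mu)) in h; [ | lra].
    unfold Rdiv in h; rewrite Rmult_assoc, Rinv_l in h; lra. }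
  assert (g_pos : forall n, 0 < gamma n) by (intros n; specialize (Hgamma n); lra).
  assert (Neta : nnsum eta) by (apply summable_nnsum; auto).
  destruct (pprod_bounded _ Neta) as [E [E1 HE]].
  set (P := pprod eta); fold P in HE.
  assert (P1 : forall n, 1 <= P n) by (intros n; apply pprod_ge1; auto).
  set (T := fun n v => hscal (P n) (U n v)).
  assert (LU : forall n, is_linear (U n)) by (intros n; split; apply (HU_bl n)).
  assert (LT : forall n, is_linear (T n)).
  { intros n; unfold T; split; intros; [rewrite (proj1 (LU n)) | rewrite (proj2 (LU n))]; vec. }
  assert (ST : forall n, self_adjoint (T n)).
  { intros n v w; unfold T; inner_expand; f_equal; apply HU_P. }
  assert (U_low : forall n v, alpha * hinner v v <= hinner (U n v) v).
  { intros n v; destruct (HU_P n) as [_ [_ h]]; specialize (h v); rewrite hinner_scal_l in h; exact h. }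
  assert (U_pos : forall n v, 0 <= hinner (U n v) v).
  { intros n v; eapply Rle_trans; [ | apply U_low]; apply Rmult_le_pos; [lra | apply hinner_pos]. }
  assert (U_up : forall n v, hinner (U n v) v <= mu * hinner v v).
  { intros n v; eapply Rle_trans; [apply inner_le_norm|]; rewrite <- norm_sq.
    pose proof (HUn n v); pose proof (norm_ge0 v); nra. }
  assert (T_low : forall n v, alpha * hinner v v <= hinner (T n v) v).
  { intros n v; unfold T; rewrite hinner_scal_l; specialize (P1 n).
    pose proof (U_low n v); pose proof (U_pos n v); nra. }
  assert (NT : forall n v, norm (T n v) = P n * norm (U n v)).
  { intros n v; unfold T; rewrite norm_scal, Rabs_pos_eq; auto; specialize (P1 n); lra. }
  assert (T_up : forall n v, norm (T n v) <= (E * mu) * norm v).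
  { intros n v; rewrite NT, Rmult_assoc; specialize (P1 n); apply Rmult_le_compat; auto; [lra | apply norm_ge0]. }
  assert (T_mono : forall n v, hinner (T n v) v <= hinner (T (S n) v) v).
  { intros n v; unfold T; rewrite !hinner_scal_l; change (P (S n)) with (P n * (1 + eta n)).
    pose proof (HU_mon n v) as h; unfold op_scal in h; rewrite hinner_scal_l in h.
    rewrite Rmult_assoc; apply Rmult_le_compat_l; auto; specialize (P1 n); lra. }
  assert (Em : 0 < E * mu) by (apply Rmult_lt_0_compat; lra).
  (* Choice over pairs yields all inverses at once. Adding [alpha] to [E * mu] ensures the
     requirement [alpha <= c] of [coercive_surjective]. *)
  destruct (choice_fun (nat * K) K (fun nv w => T (fst nv) w = snd nv)) as [Mf HMf].
  { intros [n v]; apply coercive_surjective with alpha (E * mu + alpha); auto; [lra|].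
    intros w; eapply Rle_trans; [apply T_up|]; apply Rmult_le_compat_r; [apply norm_ge0 | lra]. }
  set (M := fun n v => Mf (n, v)).
  assert (TM : forall n v, T n (M n v) = v) by (intros n v; apply (HMf (n, v))).
  set (r := fun n => hsub (p n) (b n)).
  destruct (choice_fun nat K (fun n u => A (r n) u /\ y n = hadd (r n) (hscal (gamma n) (U n u)))) as [u Hu].
  { intros n; destruct (Hp n) as [w [[u [Au ->]] Ey]]; exists u; auto. }
  set (d := fun n => gamma n / P n).
  assert (dT : forall n v, hscal (d n) (T n v) = hscal (gamma n) (U n v)).
  { intros n v; unfold d, T; specialize (P1 n); vec; field; lra. }
  assert (Hd : forall n, eps / E <= d n).
  { intros n; unfold d, Rdiv; specialize (P1 n); specialize (HE n); apply Rmult_le_compat.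
    - lra.
    - apply Rlt_le, Rinv_0_lt_compat; lra.
    - apply Hgamma.
    - apply Rinv_le_contravar; lra. }
  assert (Hstep : forall n, d n * beta * (P n * mu) <= 1 - eps).
  { intros n; specialize (P1 n); replace (d n * beta * (P n * mu)) with (gamma n * (beta * mu)) by (unfold d; field; lra).
    apply Hgbm. }
  (* The constant [C1] is [/ beta], because [gamma n * mu <= (1 - eps) / beta]. *)
  assert (HdT : forall n v, d n * norm (T n v) <= / beta * norm v).
  { intros n v; rewrite NT; specialize (P1 n).
    replace (d n * (P n * norm (U n v))) with (gamma n * norm (U n v)) by (unfold d; field; lra).
    apply Rle_trans with (gamma n * (mu * norm v)); [apply Rmult_le_compat_l; auto; specialize (g_pos n); lra|].
    rewrite <- Rmult_assoc; apply Rmult_le_compat_r; [apply norm_ge0|].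
    apply Rmult_le_reg_l with beta; auto; rewrite Rinv_r by lra; specialize (Hgbm n); lra. }
  assert (rb : forall n, hadd (r n) (b n) = p n) by (intros n; unfold r; vec).
  assert (Hr : forall n, hsub (x n) (hscal (d n) (T n (hadd (B (x n)) (a n)))) = hadd (r n) (hscal (d n) (T n (u n)))).
  { intros n; rewrite !dT, <- Hy; apply Hu. }
  assert (HX : forall n, x (S n) = hadd (hadd (r n) (b n))
    (hscal (d n) (T n (hadd (hsub (B (x n)) (B (hadd (r n) (b n)))) (hsub (a n) (c n)))))).
  { intros n; rewrite dT, rb, Hx, Hq, Hy; vec.
    rewrite !(proj1 (LU n)), !(fun v w => linear_sub (U n) v w (LU n)); inner_expand_all; ring. }
  pose proof (summable_nnsum _ (fun n => norm_ge0 (a n)) Ha) as Na.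
  pose proof (summable_nnsum _ (fun n => norm_ge0 (b n)) Hb) as Nb.
  pose proof (summable_nnsum _ (fun n => norm_ge0 (c n)) Hc) as Nc.
  assert (Ng : nnsum (fun n => norm (a n) + norm (b n) + norm (c n))).
  { apply (nnsum_add _ _ (nnsum_add _ _ Na Nb) Nc). }
  assert (dlo : 0 < eps / E) by (apply Rdiv_lt_0_compat; lra).
  assert (ib : 0 <= / beta) by (apply Rlt_le, Rinv_0_lt_compat; auto).
  assert (mp : forall n, 0 < P n * mu) by (intros n; specialize (P1 n); apply Rmult_lt_0_compat; lra).
  assert (T_m : forall n v, hinner (T n v) v <= P n * mu * hinner v v).
  { intros n v; unfold T; rewrite hinner_scal_l, Rmult_assoc; specialize (P1 n).
    apply Rmult_le_compat_l; auto; lra. }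
  assert (Au : forall n, A (r n) (u n)) by (intros n; apply Hu).
  pose proof (residual_summable A B T M d (fun n => P n * mu) alpha beta (E * mu) (/ beta) eps (eps / E) x r u a b c) as Sr.
  pose proof (increment_summable A B T M d (fun n => P n * mu) alpha beta (E * mu) (/ beta) eps (eps / E) x r u a b c) as Sx.
  pose proof (fbf_convergence A B T M d (fun n => P n * mu) alpha beta (E * mu) (/ beta) eps (eps / E) x r u a b c) as Cv.
  repeat (specialize (Sr ltac:(assumption))).
  repeat (specialize (Sx ltac:(assumption))).
  repeat (specialize (Cv ltac:(assumption))).
  destruct Cv as [xbar [Zx [Wx Sc]]].
  assert (Sp : nnsum (fun n => norm (hsub (x n) (p n)) ^ 2)).
  { apply nnsum_le with (fun n => 2 * norm (hsub (x n) (r n)) ^ 2 + 2 * norm (b n) ^ 2).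
    - apply nnsum_add; apply nnsum_scal; try lra; auto; apply nnsum_sq, Nb.
    - intros n; split; [apply pow2_ge_0|].
      pose proof (norm_sub (hsub (x n) (r n)) (b n)) as h.
      replace (hsub (hsub (x n) (r n)) (b n)) with (hsub (x n) (p n)) in h by (unfold r; vec).
      pose proof (norm_ge0 (hsub (x n) (p n))).
      apply Rle_trans with ((norm (hsub (x n) (r n)) + norm (b n)) ^ 2); [apply pow_incr; auto|].
      pose proof (pow2_ge_0 (norm (hsub (x n) (r n)) - norm (b n))); lra. }
  assert (px : Un_cv (fun n => norm (hsub (p n) (x n))) 0).
  { apply cv_ext with (fun n => norm (hsub (x n) (p n))); [intros; apply norm_sub_sym|].
    apply cv_sq0; [intros; apply norm_ge0 | apply nnsum_cv0, Sp]. }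
  exists xbar; split; [exact Zx|]; split; [split|split; [split|]].
  - apply nnsum_summable, Sp.
  - apply nnsum_summable, nnsum_le with (1 := Sx); intros n; split; [apply pow2_ge_0|].
    apply Req_le; do 2 f_equal; rewrite (Hx n); vec.
  - exact Wx.
  - apply weak_cv_near with (1 := Wx) (2 := px).
  - intros H; assert (Sx' : strong_cv x xbar).
    { apply Sc; destruct H as [H|[H|[H|[Hi [nu [nu0 [nus Hnu]]]]]]]; auto.
      (* The sequence comes from [(1 + eta n) (1 + nu n)]: passing from [T n] to [T (S n)]
         multiplies by [1 + eta n] besides replacing [U n] by [U (S n)]. *)
      right; right; right; split; auto; exists (fun n => eta n + nu n + eta n * nu n); split.
      - pose proof (summable_nnsum _ nu0 nus) as Nnu.
        apply nnsum_add; [apply nnsum_add; auto|].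
        destruct (nnsum_bounded _ Neta) as [k [k0 Hk]].
        apply nnsum_le with (1 := nnsum_scal k _ k0 Nnu); intros n; split.
        + apply Rmult_le_pos; auto.
        + apply Rmult_le_compat_r; auto.
      - intros n v; unfold T; rewrite !hinner_scal_l; change (P (S n)) with (P n * (1 + eta n)).
        pose proof (Hnu n v) as h; unfold op_scal in h; rewrite hinner_scal_l in h.
        replace ((1 + (eta n + nu n + eta n * nu n)) * (P n * hinner (U n v) v))
          with (P n * (1 + eta n) * ((1 + nu n) * hinner (U n v) v)) by ring.
        apply Rmult_le_compat_l; auto; specialize (P1 n); specialize (Heta_nonneg n); nra. }
    split; [exact Sx' | apply strong_cv_near with (1 := Sx') (2 := px)].
Qed.
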